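(* Let $a>0$, let $q\in L^2(0,a)$ be real-valued and even (i.e. $q(a-x)=q(x)$ for a.e. $x\in[0,a]$), and suppose the potential on every edge equals $q$. Write $S=S(a,\rho)$ and $S'=S'(a,\rho)$, where $S(\cdot,\rho)$ solves $-y''+qy=\rho^2y$ on $[0,a]$ with $S(0,\rho)=0$, $S'(0,\rho)=1$. Let $\theta_1,\theta_2\in[-\pi,\pi]$, $\Theta=(\theta_1,\theta_2)$. Then the dispersion relation of the periodic quantum graph (that is, the equation characterizing those $\lambda=\rho^2$ which belong to $\sigma(H^\Theta)$) is as follows. (a) For the triangular tiling $(3^6)$: $$S^2\left(3S'+1-4\cos\tfrac{\theta_1}{2}\cos\tfrac{\theta_2}{2}\cos\tfrac{\theta_2-\theta_1}{2}\right)=0.$$ (b) For the elongated triangular tiling $(3^3,4^2)$: $$S^3\left\{25(S')^2-20\cos\theta_1\,S'-8\cos\tfrac{\theta_1}{2}\cos\tfrac{\theta_2}{2}\cos\tfrac{\theta_1-\theta_2}{2}+4\cos^2\theta_1-1\right\}=0.$$ (c) For the truncated square tiling $(4,8^2)$: $$S^2\left\{81(S')^4-54(S')^2-12S'(\cos\theta_1+\cos\theta_2)+1-4\cos\theta_1\cos\theta_2\right\}=0.$$ (d) For the trihexagonal tiling $(3,6,3,6)$: $$S^3(2S'+1)\left(2(S')^2-S'-\cos\tfrac{\theta_1}{2}\cos\tfrac{\theta_2}{2}\cos\tfrac{\theta_1-\theta_2}{2}\right)=0.$$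
   Context: For each tiling, $G\subset\mathbb R^2$ is the infinite periodic graph formed by the tiling's edges, all of length $a$, invariant under translation by two linearly independent vectors $\vec k_1,\vec k_2$. Each edge is identified with $[0,a]$. The operator $H$ acts as $-y''+qy$ on each edge; its domain consists of functions that lie in the Sobolev space $\mathcal H^2(e)$ on every edge $e$, with $\sum_e\|y_e\|^2_{\mathcal H^2(e)}<\infty$, and that satisfy the Neumann (continuity–Kirchhoff) vertex conditions: at each vertex the function is continuous and the sum over incident edges of the derivatives directed away from the vertex is $0$. For $\Theta=(\theta_1,\theta_2)\in[-\pi,\pi]^2$, the Bloch Hamiltonian $H^\Theta$ is the same differential expression acting on functions on $G$ that are $\mathcal H^2$ on each edge, satisfy the Neumann vertex conditions, and satisfy the Floquet–Bloch condition $y(x+p_1\vec k_1+p_2\vec k_2)=e^{i(p_1\theta_1+p_2\theta_2)}y(x)$ for all $(p_1,p_2)\in\mathbb Z^2$; such functions are determined by their restriction to a fundamental domain, and $H^\Theta$ has purely discrete spectrum $\sigma(H^\Theta)$. The graphs, with one representative of each translation class of vertices and edges (an edge $v\to w$ is parametrized by $[0,a]$ from $v$ to $w$): - Triangular tiling: $\vec k_1=(\frac a2,\frac{\sqrt3}2a)$, $\vec k_2=(a,0)$; one vertex $v$; edges $v\to v+\vec k_1$, $v\to v+\vec k_2$, $v\to v+\vec k_2-\vec k_1$. - Elongated triangular tiling: $\vec k_1=(a,0)$, $\vec k_2=(\frac a2,(1+\frac{\sqrt3}2)a)$; vertices $v_1,v_2$; edges $e_1:v_2-\vec k_1+\vec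 k_2\to v_1$, $e_2:v_1-\vec k_1\to v_1$, $e_3:v_2-\vec k_1\to v_1$, $e_4:v_2\to v_1$, $e_5:v_2-\vec k_1\to v_2$. - Truncated square tiling: $\vec k_1=(0,(1+\sqrt2)a)$, $\vec k_2=((1+\sqrt2)a,0)$; vertices $v_1,\dots,v_4$; edges $e_1:v_1\to v_2$, $e_2:v_3\to v_2$, $e_3:v_3\to v_4$, $e_4:v_1\to v_4$, $e_5:v_1\to v_3-\vec k_1$, $e_6:v_2\to v_4-\vec k_2$. - Trihexagonal tiling: $\vec k_1=(\sqrt3a,a)$, $\vec k_2=(0,2a)$; vertices $v_1,v_2,v_3$; edges $e_1:v_1\to v_3$, $e_2:v_3\to v_2$, $e_3:v_1\to v_2$, $e_4:v_1\to v_2-\vec k_1$, $e_5:v_3-\vec k_2\to v_2-\vec k_1$, $e_6:v_1\to v_3-\vec k_2$. *)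

(* Defs.v *)
From HB Require Import structures.
From mathcomp Require Export all_boot all_order all_algebra.
From mathcomp Require Export complex.
From mathcomp Require Export all_classical all_reals all_analysis.

Set Implicit Arguments.
Unset Strict Implicit.
Unset Printing Implicit Defensive.

Export Order.TTheory GRing.Theory Num.Theory.
Export numFieldNormedType.Exports.

Global Open Scope classical_set_scope.
Global Open Scope ring_scope.
Global Open Scope complex_scope.

Section function_spaces.
Context {R : realType}.
Implicit Types (a : R) (f g y : R -> R[i]).

Local Notation mu := (@lebesgue_measure R).

Definition L2_real a (f : R -> R) : Prop :=
  measurable_fun `[0, a] f /\
  mu.-integrable `[0, a] (fun x => (f x ^+ 2)%:E).

Definition L2 a f : Prop :=
  L2_real a (fun x => complex.Re (f x)) /\ L2_real a (fun x => complex.Im (f x)).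

Definition L2_sqnorm a f : \bar R :=
  (\int[mu]_(x in `[0%R, a])
      (complex.Re (f x) ^+ 2 + complex.Im (f x) ^+ 2)%:E)%E.

Definition Cintegrable (D : set R) f : Prop :=
  mu.-integrable D (fun x => (complex.Re (f x))%:E) /\
  mu.-integrable D (fun x => (complex.Im (f x))%:E).

Definition Cintegral (D : set R) f : R[i] :=
  Rintegral mu D (fun x => complex.Re (f x)) +i*
  Rintegral mu D (fun x => complex.Im (f x)).

(* f is (absolutely) continuous on [0, a] with weak derivative g; equivalently
   f is the continuous representative of an element of W^{1,1}(0, a). Values
   outside [0, a] are irrelevant, here and below. *)
Definition weak_derivative a f g : Prop :=
  Cintegrable `[0, a] g /\
  forall x, x \in `[0, a] -> f x = f 0 + Cintegral `[0, x] g.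

(* y is in H^2(0, a), with derivative y1, and y2 is any representative of its
   second derivative. On [0, a], y1 is the classical (one-sided at the
   endpoints) derivative of y, so that y1 0 and y1 a are meaningful. *)
Definition sobolevH2 a y (y1 y2 : R -> R[i]) : Prop :=
  [/\ weak_derivative a y y1, weak_derivative a y1 y2 & L2 a y2].

Definition even_potential a (q : R -> R) : Prop :=
  {ae mu, forall x, x \in `[0, a] -> q (a - x) = q x}.

(* - y'' + q y = lam y in the Caratheodory sense, y1 being the derivative of y *)
Definition solves_schrodinger a (q : R -> R) (lam : R[i])
    y (y1 : R -> R[i]) : Prop :=
  exists y2 : R -> R[i], sobolevH2 a y y1 y2 /\
    {ae mu, forall x, x \in `[0, a] ->
      - y2 x + (q x)%:C * y x = lam * y x}.

Definition expi (t : R) : R[i] := cos t +i* sin t.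

End function_spaces.

(* A Z^2-periodic graph. The vertex classes are numbered 0, ..., nvertex - 1,
   and (v, (p1, p2)) denotes the vertex v + p1 k_1 + p2 k_2 of the plane. For
   each edge class, [ends] lists the initial and the final endpoint of its
   representative. Only the incidences of the tiling are recorded: they
   determine its metric graph, since all edges have the same length. *)
Record periodic_graph := PeriodicGraph {
  nvertex : nat;
  nedge : nat;
  ends : nedge.-tuple (('I_nvertex * (int * int)) * ('I_nvertex * (int * int)))
}.

Definition tail (G : periodic_graph) (e : 'I_(nedge G)) := (tnth (ends G) e).1.
Definition head (G : periodic_graph) (e : 'I_(nedge G)) := (tnth (ends G) e).2.

(* y e p is the function on the translate by p1 k_1 + p2 k_2 of the
   representative of the edge class e; it is relevant on [0, a] only. *)
Definition graph_function (R : realType) (G : periodic_graph) : Type :=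
  'I_(nedge G) -> int * int -> R -> R[i].

Section bloch_hamiltonian.
Context {R : realType}.
Variable G : periodic_graph.
Implicit Types (a : R) (y f z : graph_function R G).

Definition continuous_at_vertices a y : Prop :=
  exists u : 'I_(nvertex G) -> int * int -> R[i],
    forall (e : 'I_(nedge G)) (p : int * int),
      y e p 0 = u (tail e).1 ((tail e).2 + p) /\
      y e p a = u (head e).1 ((head e).2 + p).

(* The translate (e, p) starts at the vertex (v, r) iff v is the class of the
   tail of e and p = r - (tail e).2, and similarly for its final endpoint, where
   the derivative directed away from the vertex is - y1 e p a. *)
Definition kirchhoff a (y1 : graph_function R G) : Prop :=
  forall (v : 'I_(nvertex G)) (r : int * int),
    \sum_(e | (tail e).1 == v) y1 e (r - (tail e).2) 0
    - \sum_(e | (head e).1 == v) y1 e (r - (head e).2) a = 0.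

Definition floquet_bloch a (th1 th2 : R) y : Prop :=
  forall e (r p : int * int) (x : R), x \in `[0, a] ->
    y e (r + p) x = expi (p.1%:~R * th1 + p.2%:~R * th2) * y e r x.

(* The Hilbert space of H^Theta: every class modulo almost everywhere equality
   has a representative satisfying the Floquet-Bloch condition pointwise. *)
Definition bloch_L2 a (th1 th2 : R) f : Prop :=
  (forall e p, L2 a (f e p)) /\ floquet_bloch a th1 th2 f.

Definition bloch_sqnorm a f : \bar R := (\sum_e L2_sqnorm a (f e 0%R))%E.

(* The graph of H^Theta: y is in the domain and z is a representative of
   - y'' + q y (second derivatives y2 are determined only almost everywhere). *)
Definition bloch_hamiltonian a (q : R -> R) (th1 th2 : R) y z : Prop :=
  exists y1 y2 : graph_function R G,
    [/\ forall e p, sobolevH2 a (y e p) (y1 e p) (y2 e p),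
        continuous_at_vertices a y, kirchhoff a y1,
        floquet_bloch a th1 th2 y &
        forall e p x, x \in `[0, a] ->
          z e p x = - y2 e p x + (q x)%:C * y e p x].

(* lam is in the resolvent set: H^Theta - lam maps the domain onto the Hilbert
   space, and is injective with bounded inverse. *)
Definition bloch_resolvent_set a (q : R -> R) (th1 th2 : R) (lam : R[i]) : Prop :=
  (forall f, bloch_L2 a th1 th2 f ->
     exists y, bloch_hamiltonian a q th1 th2 y
                 (fun e p x => lam * y e p x + f e p x)) /\
  (exists C : R, forall y z, bloch_hamiltonian a q th1 th2 y z ->
     (bloch_sqnorm a y <=
      C%:E * bloch_sqnorm a (fun e p x => z e p x - lam * y e p x)%R)%E).

Definition bloch_spectrum a (q : R -> R) (th1 th2 : R) : set R[i] :=
  ~` [set lam | bloch_resolvent_set a q th1 th2 lam].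

End bloch_hamiltonian.

Definition triangular_tiling : periodic_graph :=
  let v : 'I_1 := ord0 in
  PeriodicGraph [tuple
    ((v, (0, 0)), (v, (1, 0)));
    ((v, (0, 0)), (v, (0, 1)));
    ((v, (0, 0)), (v, (-1, 1)))].

Definition elongated_triangular_tiling : periodic_graph :=
  let v1 : 'I_2 := @Ordinal 2 0 isT in
  let v2 : 'I_2 := @Ordinal 2 1 isT in
  PeriodicGraph [tuple
    ((v2, (-1, 1)), (v1, (0, 0)));
    ((v1, (-1, 0)), (v1, (0, 0)));
    ((v2, (-1, 0)), (v1, (0, 0)));
    ((v2, (0, 0)), (v1, (0, 0)));
    ((v2, (-1, 0)), (v2, (0, 0)))].

Definition truncated_square_tiling : periodic_graph :=
  let v1 : 'I_4 := @Ordinal 4 0 isT in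
  let v2 : 'I_4 := @Ordinal 4 1 isT in
  let v3 : 'I_4 := @Ordinal 4 2 isT in
  let v4 : 'I_4 := @Ordinal 4 3 isT in
  PeriodicGraph [tuple
    ((v1, (0, 0)), (v2, (0, 0)));
    ((v3, (0, 0)), (v2, (0, 0)));
    ((v3, (0, 0)), (v4, (0, 0)));
    ((v1, (0, 0)), (v4, (0, 0)));
    ((v1, (0, 0)), (v3, (-1, 0)));
    ((v2, (0, 0)), (v4, (0, -1)))].

Definition trihexagonal_tiling : periodic_graph :=
  let v1 : 'I_3 := @Ordinal 3 0 isT in
  let v2 : 'I_3 := @Ordinal 3 1 isT in
  let v3 : 'I_3 := @Ordinal 3 2 isT in
  PeriodicGraph [tuple
    ((v1, (0, 0)), (v3, (0, 0)));
    ((v3, (0, 0)), (v2, (0, 0)));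
    ((v1, (0, 0)), (v2, (0, 0)));
    ((v1, (0, 0)), (v2, (-1, 0)));
    ((v3, (0, -1)), (v2, (-1, 0)));
    ((v1, (0, 0)), (v3, (0, -1)))].

(* Main.v *)
(** Let lam = rho^2. Evenness of q makes T(x) = S(a - x) a second solution of
    - y'' + q y = lam y, and the Wronskian of T and S is S(a).

    If S(a) <> 0, Lagrange's identity expresses every solution y of
    - y'' + q y = lam y + f, together with its derivatives at the endpoints,
    through y(0), y(a) and integrals of f against S and T (Green's formula), and
    conversely this formula solves the equation. The Kirchhoff conditions then
    become a linear system for the vertex values in a fundamental domain, whose
    matrix M is the Floquet-weighted adjacency matrix minus S'(a) times the degree
    matrix. If det M <> 0 the system is solvable with bounds by the L^2 norm of f,
    so lam is in the resolvent set; a kernel vector of M yields an eigenfunction.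

    If S(a) = 0, multiples of S on the edges vanish at all vertices, and since
    there are more edges than vertices some nonzero combination satisfies the
    Kirchhoff conditions, so lam is an eigenvalue.

    It remains to compute det M, with 4 cos(x/2) cos(y/2) cos((x-y)/2) =
    1 + cos x + cos y + cos(x-y). *)
Require Import Defs.
From mathcomp Require Import measurable_realfun lra ring.

Set Implicit Arguments.
Unset Strict Implicit.
Unset Printing Implicit Defensive.

(** * Real functions with an integrable weak derivative *)

Section real_functions.
Context {R : realType}.
Local Notation mu := (@lebesgue_measure R).
Implicit Types (a b x : R) (f g h F G : R -> R).

Definition L1 a g := mu.-integrable `[0, a] (EFin \o g).

Definition real_weak_derivative a f g :=
  L1 a g /\ forall x, x \in `[0, a] -> f x = f 0 + \int[mu]_(t in `[0, x]) g t.

Definition continuous_itv a f := {within `[0, a], continuous f}.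

Lemma integrable_subitv a x y g : L1 a g -> 0 <= x -> y <= a ->
  mu.-integrable `[x, y] (EFin \o g).
Proof.
move=> ig x0 ya; apply: integrableS ig => //=.
by apply: subset_itv; rewrite bnd_simp.
Qed.

Lemma Rintegral_itv_sub a x y g : L1 a g -> 0 <= x -> x <= y -> y <= a ->
  \int[mu]_(t in `[0, y]) g t - \int[mu]_(t in `[0, x]) g t =
  \int[mu]_(t in `[x, y]) g t.
Proof.
move=> ig x0 xy ya.
rewrite (@Rintegral_itvB _ _ (BLeft 0) (BRight y) x) ?bnd_simp//.
  rewrite Rintegral_itv_obnd_cbnd//.
  apply: integrableS (integrable_subitv ig x0 ya) => //.
  by apply: subset_itvr; rewrite bnd_simp.
exact: integrable_subitv ig _ ya.
Qed.

Lemma continuous_itv_measurable a f :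
  continuous_itv a f -> measurable_fun `[0, a] f.
Proof. by move=> cf; apply: subspace_continuous_measurable_fun. Qed.

Lemma continuous_itv_bounded a f : continuous_itv a f ->
  exists M, 0 <= M /\ forall x, x \in `[0, a] -> `|f x| <= M.
Proof.
move=> cf; have [a0|a0] := ltP a 0.
  by exists 0; split=> // x /[!in_itv]/= /andP[x0 /(le_trans x0)]; lra.
have [c _ fc] := EVT_max a0 cf; have [d _ fd] := EVT_min a0 cf.
exists (`|f c| + `|f d|); split=> [|x xa]; first by rewrite addr_ge0.
have := fc _ xa; have := fd _ xa.
have := ler_norm (f c); have := ler_norm (- f d); rewrite normrN.
have := normr_ge0 (f c); have := normr_ge0 (f d).
by rewrite ler_norml => *; apply/andP; split; lra.
Qed.

Lemma continuous_itv_integrable a f : continuous_itv a f -> L1 a f.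
Proof.
by move=> cf; apply: continuous_compact_integrable => //; exact: segment_compact.
Qed.

Lemma continuous_itv_cst a (c : R) : continuous_itv a (fun=> c).
Proof. by move=> x; exact: cst_continuous. Qed.

Lemma continuous_itvD a f g : continuous_itv a f -> continuous_itv a g ->
  continuous_itv a (fun x => f x + g x).
Proof. by move=> cf cg x; apply: cvgD; [exact: cf|exact: cg]. Qed.

Lemma continuous_itvN a f : continuous_itv a f ->
  continuous_itv a (fun x => - f x).
Proof. by move=> cf x; apply: cvgN; exact: cf. Qed.

Lemma continuous_itvM a f g : continuous_itv a f -> continuous_itv a g ->
  continuous_itv a (fun x => f x * g x).
Proof. by move=> cf cg x; apply: cvgM; [exact: cf|exact: cg]. Qed.

Lemma eq_continuous_itv a f g : {in `[0, a], f =1 g} -> continuous_itv a f ->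
  continuous_itv a g.
Proof.
move=> fg; apply: subspace_eq_continuous => x /set_mem/= xa.
exact: fg.
Qed.

Lemma continuous_itv_primitive a g : 0 <= a -> L1 a g ->
  continuous_itv a (fun x => \int[mu]_(t in `[0, x]) g t).
Proof. by move=> a0 ig; exact: parameterized_integral_continuous. Qed.

Lemma L1M a f g : continuous_itv a f -> L1 a g -> L1 a (fun x => f x * g x).
Proof.
move=> cf ig.
have [M [M0 fM]] := continuous_itv_bounded cf.
have := @integrableMr _ _ _ mu `[0, a]%classic _ f (EFin \o g)
  (continuous_itv_measurable cf) _ ig.
apply => //; exists M; split; first exact: num_real.
by move=> N MN x /= xa; rewrite (le_trans (fM _ xa))// ltW.
Qed.

Lemma L1D a f g : L1 a f -> L1 a g -> L1 a (fun x => f x + g x).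
Proof. by move=> i1 i2; exact: (integrableD _ i1 i2). Qed.

Lemma L1N a f : L1 a f -> L1 a (fun x => - f x).
Proof. by move=> i1; exact: (integrableN i1). Qed.

Lemma L1_norm a f : L1 a f -> L1 a (fun x => `|f x|).
Proof. exact: integrable_norm. Qed.

Lemma real_weak_derivative_continuous a f g : 0 <= a ->
  real_weak_derivative a f g -> continuous_itv a f.
Proof.
move=> a0 [ig fE].
apply: (@eq_continuous_itv _ (fun x => f 0 + \int[mu]_(t in `[0, x]) g t)).
  by move=> x /fE.
apply: continuous_itvD (continuous_itv_primitive a0 ig).
exact: continuous_itv_cst.
Qed.

Lemma real_weak_derivative_sub a f g x y : real_weak_derivative a f g ->
  0 <= x -> x <= y -> y <= a -> f y - f x = \int[mu]_(t in `[x, y]) g t.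
Proof.
move=> [ig fE] x0 xy ya; rewrite -(Rintegral_itv_sub ig)//.
rewrite (fE x) ?(fE y) ?in_itv/= ?x0 ?ya ?(le_trans xy) ?(le_trans x0)//.
by ring.
Qed.

(* A function whose increments are quadratically small with respect to those of
   a continuous function is constant: bisect the range of the latter. *)
Lemma quadratic_increments_eq a (c : R) (phi gam : R -> R) : 0 <= c ->
  continuous_itv a gam ->
  (forall x y, 0 <= x -> x <= y -> y <= a -> gam x <= gam y) ->
  (forall x y, 0 <= x -> x <= y -> y <= a ->
    `|phi y - phi x| <= c * (gam y - gam x) ^+ 2) ->
  forall x y, 0 <= x -> x <= y -> y <= a -> phi x = phi y.
Proof.
move=> c0 cg mg H x y x0 xy ya.
have Hn n : forall x y, 0 <= x -> x <= y -> y <= a ->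
    `|phi y - phi x| <= c * (gam y - gam x) ^+ 2 / 2 ^+ n.
  elim: n => [|n IHn] {x0 xy ya}x {}y x0 xy ya.
    by rewrite expr0 divr1; exact: H.
  have gxy := mg _ _ x0 xy ya.
  have cg' : {within `[x, y], continuous gam}.
    by apply: continuous_subspaceW cg; apply: subset_itv; rewrite bnd_simp.
  (* At [m] the function [gam] is halfway between its end values, so each half costs a quarter of
     the bound for the whole and the two together cost half of it: one factor 1/2 per bisection. *)
  have [|m] := @IVT _ gam x y ((gam x + gam y) / 2) xy cg'.
    by rewrite min_l// max_r//; apply/andP; split; lra.
  rewrite in_itv/= => /andP[xm my] gm.
  have H1 := IHn x m x0 xm (le_trans my ya).
  have H2 := IHn m y (le_trans x0 xm) my ya.
  rewrite -(subrKA (phi m)) (le_trans (ler_normD _ _))//.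
  apply: (le_trans (lerD H2 H1)); rewrite gm [2 ^+ n.+1]exprS.
  by rewrite le_eqVlt; apply/orP; left; apply/eqP; field; rewrite expf_neq0.
apply/eqP; rewrite eq_sym -subr_eq0 -normr_le0; apply/ler_addgt0Pl => e e0.
rewrite addr0; set K := c * (gam y - gam x) ^+ 2.
have K0 : 0 <= K by rewrite mulr_ge0// sqr_ge0.
(* With [n] above [K / e], the inequality [n < 2 ^ n] brings [K / 2 ^ n] below [e]. *)
pose n := (Num.truncn (K / e)).+1.
apply: le_trans (Hn n x y x0 xy ya) _; rewrite -/K ler_pdivrMr ?exprn_gt0//.
rewrite mulrC -ler_pdivrMr//.
have /ltW := truncnS_gt (K / e); move=> /le_trans; apply.
by rewrite -natrX ler_nat -/n ltnW// ltn_expl.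
Qed.

Lemma le_Rintegral_itv_sub a x t y h : L1 a h -> (forall s, 0 <= h s) ->
  0 <= x -> x <= t -> t <= y -> y <= a ->
  \int[mu]_(s in `[x, t]) h s <= \int[mu]_(s in `[x, y]) h s.
Proof.
move=> ih h0 x0 xt ty ya.
have t0 := le_trans x0 xt; have xy := le_trans xt ty; have ta := le_trans ty ya.
rewrite -(Rintegral_itv_sub ih x0 xt ta) -(Rintegral_itv_sub ih x0 xy ya).
rewrite lerD2r -subr_ge0 (Rintegral_itv_sub ih t0 ty ya).
by apply: Rintegral_ge0.
Qed.

Lemma real_weak_derivative_norm_sub a x t y f g h :
  real_weak_derivative a f g -> L1 a h -> (forall s, `|g s| <= h s) ->
  0 <= x -> x <= t -> t <= y -> y <= a ->
  `|f t - f x| <= \int[mu]_(s in `[x, y]) h s.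
Proof.
move=> dfg ih gh x0 xt ty ya.
have h0 s : 0 <= h s by exact: le_trans (gh s).
have ta := le_trans ty ya.
have ig := integrable_subitv dfg.1 x0 ta.
rewrite (real_weak_derivative_sub dfg)//.
apply: le_trans (le_Rintegral_itv_sub ih h0 x0 xt ty ya).
apply: le_trans (le_normr_Rintegral _ ig) _ => //.
apply: le_Rintegral => //.
- exact: integrable_norm.
- exact: integrable_subitv ih x0 ta.
Qed.

(** Freezing [f] at the left endpoint costs at most the integral of [h], because [h] dominates the
    derivative [g]; integrating this error against [G], which [h] dominates too, gives the
    square. *)
Lemma norm_Rintegral_mul_sub a x y f g h G :
  real_weak_derivative a f g -> L1 a h -> L1 a G ->
  (forall s, `|g s| <= h s) -> (forall s, `|G s| <= h s) ->
  0 <= x -> x <= y -> y <= a ->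
  `|\int[mu]_(s in `[x, y]) (f s * G s) - f x * \int[mu]_(s in `[x, y]) G s|
    <= (\int[mu]_(s in `[x, y]) h s) ^+ 2.
Proof.
move=> dfg ih iG gh Gh x0 xy ya; set d := \int[mu]_(s in _) h s.
have h0 s : 0 <= h s by exact: le_trans (gh s).
have d0 : 0 <= d by exact: Rintegral_ge0.
have cf := real_weak_derivative_continuous (le_trans x0 (le_trans xy ya)) dfg.
have iGxy := integrable_subitv iG x0 ya.
have ifG := integrable_subitv (L1M cf iG) x0 ya.
have ihxy := integrable_subitv ih x0 ya.
have iM := integrable_subitv (L1M (@continuous_itv_cst a (f x)) iG) x0 ya.
rewrite -RintegralZl// -RintegralB//.
have ifGB := integrable_subitv (L1D (L1M cf iG) (L1N
  (L1M (@continuous_itv_cst a (f x)) iG))) x0 ya.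
apply: le_trans (le_normr_Rintegral _ ifGB) _ => //.
rewrite expr2 -RintegralZl//; apply: le_Rintegral => //.
- exact: integrable_norm ifGB.
- exact: (integrable_subitv (L1M (@continuous_itv_cst a d) ih) x0 ya).
move=> s /=; rewrite in_itv/= => /andP[xs sy].
rewrite -mulrBl normrM ler_pM//.
exact: (real_weak_derivative_norm_sub dfg ih gh x0 xs sy ya).
Qed.

(** The defect [phi] in the product rule has quadratically small increments relative to the
    primitive [gam] of [|g| + |G|], hence is constant. The constant 3 counts two freezing errors and
    the product of the increments of [f] and [F]. *)
Lemma real_weak_derivativeM a f g F G : 0 <= a ->
  real_weak_derivative a f g -> real_weak_derivative a F G ->
  real_weak_derivative a (fun x => f x * F x) (fun x => f x * G x + F x * g x).
Proof.
move=> a0 df dF.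
have cf := real_weak_derivative_continuous a0 df.
have cF := real_weak_derivative_continuous a0 dF.
have ig := df.1; have iG := dF.1.
have ifG := L1M cf iG; have iFg := L1M cF ig.
have iD := L1D ifG iFg.
split=> // x /[!in_itv]/= /andP[x0 xa].
pose h s := `|g s| + `|G s|.
have ih : L1 a h by exact: L1D (L1_norm ig) (L1_norm iG).
have gh s : `|g s| <= h s by rewrite lerDl.
have Gh s : `|G s| <= h s by rewrite lerDr.
pose gam x := \int[mu]_(s in `[0, x]) h s.
pose phi x := f x * F x - \int[mu]_(s in `[0, x]) (f s * G s + F s * g s).
suff : phi 0 = phi x.
  rewrite /phi set_itv1 Rintegral_set1 subr0 => ->.
  by rewrite subrK.
apply: (@quadratic_increments_eq a 3 phi gam) => //.
- exact: continuous_itv_primitive.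
- move=> u v u0 uv va; rewrite -subr_ge0 (Rintegral_itv_sub ih)//.
  by apply: Rintegral_ge0 => s _; rewrite addr_ge0.
move=> u v u0 uv va; rewrite (Rintegral_itv_sub ih)//.
set d := \int[mu]_(s in _) h s.
have duvf : f v - f u = \int[mu]_(s in `[u, v]) g s.
  exact: real_weak_derivative_sub df _ _ _.
have duvF : F v - F u = \int[mu]_(s in `[u, v]) G s.
  exact: real_weak_derivative_sub dF _ _ _.
have := norm_Rintegral_mul_sub df ih iG gh Gh u0 uv va.
have := norm_Rintegral_mul_sub dF ih ig Gh gh u0 uv va.
rewrite -duvF -duvf -/d.
have := real_weak_derivative_norm_sub df ih gh u0 uv (lexx _) va.
have := real_weak_derivative_norm_sub dF ih Gh u0 uv (lexx _) va.
rewrite -/d => b1 b2.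
have b3 : `|(f v - f u) * (F v - F u)| <= d ^+ 2.
  by rewrite normrM expr2 ler_pM.
have -> : phi v - phi u = f v * F v - f u * F u -
  \int[mu]_(s in `[u, v]) (f s * G s) - \int[mu]_(s in `[u, v]) (F s * g s).
  rewrite /phi -(subrKA 0) -[RHS]addrA -opprD -RintegralD//.
  - by rewrite -(Rintegral_itv_sub iD u0 uv va); ring.
  - exact: integrable_subitv ifG _ _.
  - exact: integrable_subitv iFg _ _.
set I1 := \int[mu]_(s in _) _; set I2 := \int[mu]_(s in _) _.
move: b3; rewrite !ler_norml => /andP[? ?] /andP[? ?] /andP[? ?].
by apply/andP; split; lra.
Qed.

Lemma real_weak_derivative_cst a c : real_weak_derivative a (fun=> c) (fun=> 0).
Proof.
split; first exact: integrable0.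
by move=> x xa; rewrite Rintegral_cst// mul0r addr0.
Qed.

Lemma real_weak_derivativeD a f g F G :
  real_weak_derivative a f g -> real_weak_derivative a F G ->
  real_weak_derivative a (fun x => f x + F x) (fun x => g x + G x).
Proof.
move=> [ig fE] [iG FE]; split; first exact: L1D.
move=> x xa; move: (xa); rewrite in_itv/= => /andP[x0 xa'].
rewrite (fE _ xa) (FE _ xa) RintegralD//.
- by rewrite addrACA.
- exact: integrable_subitv ig _ _.
- exact: integrable_subitv iG _ _.
Qed.

Lemma real_weak_derivative_primitive a g c : 0 <= a -> L1 a g ->
  real_weak_derivative a (fun x => c + \int[mu]_(t in `[0, x]) g t) g.
Proof.
move=> a0 ig; split=> // x xa.
by rewrite set_itv1 Rintegral_set1 addr0.
Qed.

Lemma aeS (P Q : R -> Prop) : (forall t, P t -> Q t) ->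
  {ae mu, forall x, P x} -> {ae mu, forall x, Q x}.
Proof.
by move=> PQ; apply: filterS PQ; first exact: (ae_filter_ringOfSetsType mu).
Qed.

(** Second derivatives are known only almost everywhere; this allows replacing them by the
    expression that the differential equation prescribes. *)
Lemma ae_real_weak_derivative a f g g' :
  measurable_fun `[0, a] g' ->
  {ae mu, forall x, x \in `[0, a] -> g x = g' x} ->
  real_weak_derivative a f g -> real_weak_derivative a f g'.
Proof.
move=> mg' gg' [ig fE].
have E y (D : set R) : y <= a -> D = `[0, y]%classic ->
  ae_eq mu D (EFin \o g) (EFin \o g').
  move=> ya ->; apply: aeS gg' => t gt; rewrite /= in_itv/= => /andP[t0 ty].
  by rewrite gt// in_itv/= t0 (le_trans ty).
split.
  move: ig => /integrableP[mg ig]; apply/integrableP; split.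
    exact/measurable_EFinP.
  apply: le_lt_trans ig.
  rewrite (@ae_eq_integral _ _ _ mu _ (abse \o (EFin \o g)) (abse \o (EFin \o g')))//.
  - by apply: measurableT_comp => //; exact/measurable_EFinP.
  - exact: measurableT_comp.
  - apply: ae_eq_sym; apply: ae_eq_comp; exact: (E a).
move=> x xa; rewrite fE//; congr (_ + fine _).
move: xa; rewrite in_itv/= => /andP[x0 xa].
apply: ae_eq_integral => //.
- exact: measurable_int (integrable_subitv ig _ _).
- apply/measurable_EFinP; apply: measurable_funS mg' => //.
  by apply: subset_itv; rewrite bnd_simp.
- exact: (E x).
Qed.

(** If [h c] were nonzero, [h] would stay within [|h c| / 2] of [h c] on an interval around [c], and
    its integral there, a difference of two vanishing integrals, could not be 0. *)
Lemma continuous_itv_eq0 a h : 0 < a -> continuous_itv a h ->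
  (forall x, x \in `[0, a] -> \int[mu]_(t in `[0, x]) h t = 0) ->
  forall x, x \in `[0, a] -> h x = 0.
Proof.
move=> a0 ch h0 c ca.
apply/eqP; rewrite -normr_eq0; apply/negPn/negP => hc.
have {hc} hc : 0 < `|h c| / 2 by rewrite divr_gt0// lt_def hc normr_ge0.
have /subspace_continuousP/(_ c ca) := ch.
move=> /cvgrPdist_lt/(_ _ hc)/nbhs_ballP[d /= d0 dP].
move: (ca); rewrite in_itv/= => /andP[c0 ca'].
(* The interval is clipped to [[0, a]]; since [0 < a], it keeps positive length even when [c] is an
   endpoint. *)
pose x := Num.max 0 (c - d / 2); pose y := Num.min a (c + d / 2).
have x0 : 0 <= x by rewrite /x le_max lexx.
have ya : y <= a by rewrite /y ge_min lexx.
have xc : x <= c by rewrite /x ge_max c0; lra.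
have cy : c <= y by rewrite /y le_min ca'; lra.
have xy : x < y.
  by rewrite /x /y lt_min !gt_max; apply/andP; split; apply/andP; split; lra.
have xd : c - d / 2 <= x by rewrite /x le_max lexx orbT.
have yd : y <= c + d / 2 by rewrite /y ge_min lexx orbT.
have ih := continuous_itv_integrable ch.
have ihxy := integrable_subitv ih x0 ya.
have cc := @continuous_itv_cst a (h c).
have icxy := integrable_subitv (continuous_itv_integrable cc) x0 ya.
have I0 : \int[mu]_(t in `[x, y]) h t = 0.
  rewrite -(Rintegral_itv_sub ih x0 (ltW xy) ya) !h0 ?subrr// in_itv/=.
    by rewrite ya (le_trans x0 (ltW xy)).
  by rewrite x0 (le_trans (ltW xy)).
have muxy : fine (mu `[x, y]) = y - x.
  by rewrite lebesgue_measure_itv/= lte_fin xy.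
have /= : `|\int[mu]_(t in `[x, y]) (h c - h t)| <= `|h c| / 2 * (y - x).
  rewrite -muxy -(Rintegral_cst _ _ (`|h c| / 2))//.
  have idxy := integrable_subitv (L1D (continuous_itv_integrable cc) (L1N ih)) x0 ya.
  apply: le_trans (le_normr_Rintegral _ idxy) _ => //.
  apply: le_Rintegral => //.
  - exact: integrable_norm idxy.
  - exact: integrable_subitv (continuous_itv_integrable
      (@continuous_itv_cst a (`|h c| / 2))) x0 ya.
  move=> t /=; rewrite in_itv/= => /andP[xt ty]; apply/ltW/dP; last first.
    by rewrite /= in_itv/= (le_trans x0 xt) (le_trans ty ya).
  by rewrite /ball/= ltr_norml; apply/andP; split; lra.
rewrite RintegralB// I0 subr0 Rintegral_cst// muxy normrM.
rewrite [X in _ * X]gtr0_norm ?subr_gt0// ler_pM2r ?subr_gt0//.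
by move: hc; lra.
Qed.

Lemma ge0_continuous_itv_eq0 a h : 0 < a -> continuous_itv a h ->
  (forall x, 0 <= h x) -> \int[mu]_(t in `[0, a]) h t = 0 ->
  forall x, x \in `[0, a] -> h x = 0.
Proof.
move=> a0 ch h0 I0; apply: continuous_itv_eq0 => // x.
rewrite in_itv/= => /andP[x0 xa]; apply/eqP; rewrite eq_le Rintegral_ge0// andbT.
have := le_Rintegral_itv_sub (continuous_itv_integrable ch) h0 (lexx 0) x0 xa.
by rewrite I0; apply.
Qed.

Lemma real_weak_derivative0_eq0 a f g : 0 < a -> continuous_itv a g ->
  real_weak_derivative a f g -> (forall x, x \in `[0, a] -> f x = 0) ->
  forall x, x \in `[0, a] -> g x = 0.
Proof.
move=> a0 cg [ig fE] f0; apply: continuous_itv_eq0 => // x xa.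
have z0 : 0 \in `[0, a] by rewrite in_itv/= lexx ltW.
by have := fE x xa; rewrite (f0 _ xa) (f0 _ z0) add0r.
Qed.

(** * Reflection of the interval *)

Lemma measurable_reflect (c : R) :
  measurable_fun setT ((fun x => c - x) : R -> measurableTypeR R).
Proof. exact: measurable_funB. Qed.

Lemma preimage_reflect_itv (c x y : R) (b1 b2 : bool) :
  (fun t => c - t) @^-1` [set` Interval (BSide b1 x) (BSide b2 y)] =
  [set` Interval (BSide (~~ b2) (c - y)) (BSide (~~ b1) (c - x))].
Proof.
apply/seteqP; split=> t /=; rewrite !in_itv/= => /andP[].
  by case: b1; case: b2 => /= *; apply/andP; split; lra.
by case: b1; case: b2 => /= *; apply/andP; split; lra.
Qed.

(** Uniqueness of Lebesgue measure reduces the claim to half-open intervals. Reflection moves the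
    open end to the other side, which does not affect the length. *)
Lemma lebesgue_measure_reflect (c : R) (A : set R) : measurable A ->
  pushforward mu ((fun x => c - x) : R -> measurableTypeR R) A = mu A.
Proof.
move=> mA; have mr := measurable_reflect c.
apply/esym/lebesgue_measure_unique => //= _ [[x y]] _ <-.
rewrite /pushforward (@preimage_reflect_itv c x y false false)/=.
rewrite !lebesgue_measure_itv/= !lte_fin.
have -> : (c - y < c - x) = (x < y) by apply/idP/idP; lra.
by case: ifP => // _; rewrite -!EFinD; congr EFin; lra.
Qed.

Lemma integral_reflect (c : R) (D : set R) (f : R -> \bar R) : measurable D ->
  measurable_fun D f ->
  (\int[mu]_(x in D) f x =
   \int[mu]_(x in (fun x => c - x)%R @^-1` D) f (c - x)%R)%E.
Proof.
move=> mD mf; have mr := measurable_reflect c.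
have H (h : R -> \bar R) : measurable_fun D h -> (forall x, 0 <= h x)%E ->
    (\int[mu]_(x in D) h x =
     \int[mu]_(x in (fun x => c - x)%R @^-1` D) h (c - x)%R)%E.
  move=> mh h0.
  pose phi := (fun x => (c - x)%R) : R -> measurableTypeR R.
  rewrite -[RHS]/(\int[mu]_(x in phi @^-1` D) (h \o phi) x)%E.
  rewrite -[RHS]ge0_integral_pushforward//.
  by apply: eq_measure_integral => //= A mA AS; exact/esym/lebesgue_measure_reflect.
(* The change of variables [H] is for nonnegative functions, so it is applied to the positive and
   negative parts. *)
rewrite integralE [RHS]integralE; congr (_ - _)%E.
- rewrite H; [|exact: measurable_funepos|by []].
  by apply: eq_integral => x _; rewrite unlock.
- rewrite H; [|exact: measurable_funeneg|by []].
  by apply: eq_integral => x _; rewrite unlock.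
Qed.

Lemma measurable_fun_reflect a (f : R -> R) : measurable_fun `[0, a] f ->
  measurable_fun `[0, a] (fun x => f (a - x)).
Proof.
move=> mf; apply: (@measurable_comp _ _ _ _ _ _ `[0, a]%classic) => //.
- by move=> _ [x + <-]; rewrite /= !in_itv/= => /andP[? ?]; apply/andP; split; lra.
- exact: measurable_funS (measurable_reflect a).
Qed.

Lemma L1_reflect a f : L1 a f -> L1 a (fun x => f (a - x)).
Proof.
move=> /integrableP[mf fi]; apply/integrableP; split.
  apply/measurable_EFinP; apply: measurable_fun_reflect; exact/measurable_EFinP.
apply: le_lt_trans fi; rewrite [leRHS](@integral_reflect a)//.
  by rewrite (@preimage_reflect_itv a 0 a true false) subr0 subrr.
exact: measurableT_comp.
Qed.

Lemma real_weak_derivative_reflect a f g : 0 <= a ->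
  real_weak_derivative a f g ->
  real_weak_derivative a (fun x => f (a - x)) (fun x => - g (a - x)).
Proof.
move=> a0 dfg; have [ig _] := dfg; split; first exact/L1N/L1_reflect.
move=> x /[!in_itv]/= /andP[x0 xa].
have ax0 : 0 <= a - x by lra.
have axa : a - x <= a by lra.
have := real_weak_derivative_sub dfg ax0 axa (lexx _).
rewrite subr0 {1}/Rintegral (@integral_reflect a)//; last first.
  exact: measurable_int (integrable_subitv ig ax0 (lexx _)).
rewrite (@preimage_reflect_itv a (a - x) a true false)/= subrr subKr.
rewrite -/(Rintegral mu `[0, x] (fun t => g (a - t))) => E.
under eq_Rintegral do rewrite -mulN1r.
rewrite RintegralZl//; last first.
  exact: integrable_subitv (L1_reflect ig) (lexx _) xa.
by rewrite -E; ring.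
Qed.

End real_functions.

(** * Complex-valued functions *)

Section complex_functions.
Context {R : realType}.
Local Notation mu := (@lebesgue_measure R).
Local Notation Re := complex.Re.
Local Notation Im := complex.Im.
Implicit Types (a x : R) (f g h u : R -> R[i]) (z w : R[i]).

Lemma ReD z w : Re (z + w) = Re z + Re w. Proof. by case: z; case: w. Qed.
Lemma ImD z w : Im (z + w) = Im z + Im w. Proof. by case: z; case: w. Qed.
Lemma ReN z : Re (- z) = - Re z. Proof. by case: z. Qed.
Lemma ImN z : Im (- z) = - Im z. Proof. by case: z. Qed.
Lemma ReM z w : Re (z * w) = Re z * Re w - Im z * Im w.
Proof. by case: z; case: w. Qed.
Lemma ImM z w : Im (z * w) = Re z * Im w + Im z * Re w.
Proof. by case: z; case: w. Qed.

Lemma complex_eqP z w : Re z = Re w -> Im z = Im w -> z = w.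
Proof. by case: z => ? ?; case: w => ? ? /= -> ->. Qed.

Definition ccontinuous a f :=
  continuous_itv a (fun x => Re (f x)) /\ continuous_itv a (fun x => Im (f x)).

Lemma ccontinuousD a f g : ccontinuous a f -> ccontinuous a g ->
  ccontinuous a (fun x => f x + g x).
Proof.
move=> [f1 f2] [g1 g2]; split.
- under eq_fun do rewrite ReD; exact: continuous_itvD.
- under eq_fun do rewrite ImD; exact: continuous_itvD.
Qed.

Lemma ccontinuousM a f g : ccontinuous a f -> ccontinuous a g ->
  ccontinuous a (fun x => f x * g x).
Proof.
move=> [f1 f2] [g1 g2]; split.
- under eq_fun do rewrite ReM.
  by apply: continuous_itvD; [|apply: continuous_itvN]; exact: continuous_itvM.
- under eq_fun do rewrite ImM.
  by apply: continuous_itvD; exact: continuous_itvM.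
Qed.

Lemma ccontinuous_cst a z : ccontinuous a (fun=> z).
Proof. by split; exact: continuous_itv_cst. Qed.

Definition CL1 a f := Cintegrable `[0, a] f.

Lemma weak_derivativeP a f g : weak_derivative a f g <->
  real_weak_derivative a (fun x => Re (f x)) (fun x => Re (g x)) /\
  real_weak_derivative a (fun x => Im (f x)) (fun x => Im (g x)).
Proof.
split=> [[[i1 i2] fE]|[[i1 f1] [i2 f2]]].
  split; split=> // x /fE -> /=; first by rewrite ReD.
  by rewrite ImD.
split=> // x xa; apply: complex_eqP; first by rewrite ReD f1.
by rewrite ImD f2.
Qed.

Lemma weak_derivative_continuous a f g : 0 <= a -> weak_derivative a f g ->
  ccontinuous a f.
Proof.
move=> a0 /weak_derivativeP[f1 f2].
by split; apply: real_weak_derivative_continuous a0 _; [exact: f1|exact: f2].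
Qed.

Lemma weak_derivative_cst a z : weak_derivative a (fun=> z) (fun=> 0).
Proof. by apply/weak_derivativeP; split; exact: real_weak_derivative_cst. Qed.

Lemma weak_derivativeD a f f' g g' :
  weak_derivative a f f' -> weak_derivative a g g' ->
  weak_derivative a (fun x => f x + g x) (fun x => f' x + g' x).
Proof.
move=> /weak_derivativeP[f1 f2] /weak_derivativeP[g1 g2].
apply/weak_derivativeP; split.
- have := real_weak_derivativeD f1 g1.
  by congr real_weak_derivative; apply/funext => x; rewrite ReD.
- have := real_weak_derivativeD f2 g2.
  by congr real_weak_derivative; apply/funext => x; rewrite ImD.
Qed.

Lemma weak_derivativeM a f f' g g' : 0 <= a ->
  weak_derivative a f f' -> weak_derivative a g g' ->
  weak_derivative a (fun x => f x * g x) (fun x => f x * g' x + g x * f' x).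
Proof.
move=> a0 /weak_derivativeP[f1 f2] /weak_derivativeP[g1 g2].
(* Multiplication by the constant -1 provides the minus sign in the real part of a product. *)
have c := real_weak_derivativeM a0 (real_weak_derivative_cst a (-1)).
apply/weak_derivativeP; split.
- have := real_weak_derivativeD (real_weak_derivativeM a0 f1 g1)
    (c _ _ (real_weak_derivativeM a0 f2 g2)).
  by congr real_weak_derivative; apply/funext => x;
    rewrite ?ReD ?ReM ?ImM; ring.
- have := real_weak_derivativeD (real_weak_derivativeM a0 f1 g2)
    (real_weak_derivativeM a0 f2 g1).
  by congr real_weak_derivative; apply/funext => x;
    rewrite ?ImD ?ReM ?ImM; ring.
Qed.

Lemma weak_derivativeZ a z f f' : 0 <= a -> weak_derivative a f f' ->
  weak_derivative a (fun x => z * f x) (fun x => z * f' x).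
Proof.
move=> a0 df; have := weak_derivativeM a0 (weak_derivative_cst a z) df.
by congr weak_derivative; apply/funext => x; ring.
Qed.

Lemma weak_derivativeB a f f' g g' : 0 <= a ->
  weak_derivative a f f' -> weak_derivative a g g' ->
  weak_derivative a (fun x => f x - g x) (fun x => f' x - g' x).
Proof.
move=> a0 df dg; have := weak_derivativeD df (weak_derivativeZ (-1) a0 dg).
by congr weak_derivative; apply/funext => x; ring.
Qed.

Lemma ae_weak_derivative a f g g' : CL1 a g' ->
  {ae mu, forall x, x \in `[0, a] -> g x = g' x} ->
  weak_derivative a f g -> weak_derivative a f g'.
Proof.
move=> [i1 i2] gg' /weak_derivativeP[f1 f2]; apply/weak_derivativeP; split.
- apply: ae_real_weak_derivative f1.
  + by apply/measurable_EFinP; exact: measurable_int i1.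
  + by apply: aeS gg' => x H /H ->.
- apply: ae_real_weak_derivative f2.
  + by apply/measurable_EFinP; exact: measurable_int i2.
  + by apply: aeS gg' => x H /H ->.
Qed.

Lemma weak_derivative_primitive a g z : 0 <= a -> CL1 a g ->
  weak_derivative a (fun x => z + Cintegral `[0, x] g) g.
Proof.
move=> a0 [i1 i2]; apply/weak_derivativeP; split.
- have := real_weak_derivative_primitive (Re z) a0 i1.
  by congr real_weak_derivative; apply/funext => x; rewrite ReD.
- have := real_weak_derivative_primitive (Im z) a0 i2.
  by congr real_weak_derivative; apply/funext => x; rewrite ImD.
Qed.

Lemma weak_derivative_reflect a f g : 0 <= a -> weak_derivative a f g ->
  weak_derivative a (fun x => f (a - x)) (fun x => - g (a - x)).
Proof.
move=> a0 /weak_derivativeP[f1 f2]; apply/weak_derivativeP; split.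
- have := real_weak_derivative_reflect a0 f1.
  by congr real_weak_derivative; apply/funext => x; rewrite ReN.
- have := real_weak_derivative_reflect a0 f2.
  by congr real_weak_derivative; apply/funext => x; rewrite ImN.
Qed.

Lemma weak_derivative0_eq0 a f g : 0 < a -> ccontinuous a g ->
  weak_derivative a f g -> (forall x, x \in `[0, a] -> f x = 0) ->
  forall x, x \in `[0, a] -> g x = 0.
Proof.
move=> a0 [c1 c2] /weak_derivativeP[f1 f2] f0 x xa; apply: complex_eqP.
- by apply: (real_weak_derivative0_eq0 a0 c1 f1) => // t ta; rewrite f0.
- by apply: (real_weak_derivative0_eq0 a0 c2 f2) => // t ta; rewrite f0.
Qed.

(** The Floquet-Bloch condition is imposed on functions only; this carries it over to their
    derivatives, pointwise up to the endpoints. *)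
Lemma weak_derivative_unique a f g f' g' : 0 < a ->
  ccontinuous a f' -> ccontinuous a g' ->
  weak_derivative a f f' -> weak_derivative a g g' ->
  {in `[0, a], f =1 g} -> {in `[0, a], f' =1 g'}.
Proof.
move=> a0 cf cg df dg fg x xa; apply/eqP; rewrite -subr_eq0 -mulN1r; apply/eqP.
have cc := ccontinuousD cf (ccontinuousM (ccontinuous_cst a (-1)) cg).
apply: (weak_derivative0_eq0 a0 cc _ _ xa (f := fun x => f x - g x)).
  have := weak_derivativeB (ltW a0) df dg.
  by congr weak_derivative; apply/funext => t; rewrite mulN1r.
by move=> t /fg ->; rewrite subrr.
Qed.

End complex_functions.

(** * Square-integrable functions *)

Section square_integrable.
Context {R : realType}.
Local Notation mu := (@lebesgue_measure R).
Local Notation Re := complex.Re.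
Local Notation Im := complex.Im.
Implicit Types (a x : R) (h k : R -> R) (f g u : R -> R[i]) (z w : R[i]).

Lemma L2_realP a h : L2_real a h <->
  measurable_fun `[0, a] h /\ L1 a (fun x => h x ^+ 2).
Proof. by []. Qed.

Lemma L2_realD a h k : L2_real a h -> L2_real a k ->
  L2_real a (fun x => h x + k x).
Proof.
move=> /L2_realP[mh ih] /L2_realP[mk ik]; apply/L2_realP.
have mhk := measurable_funD mh mk; split=> //.
have c2 := @continuous_itv_cst R a 2.
apply: (@le_integrable _ _ _ mu _ _ _
  (EFin \o (fun x => 2 * h x ^+ 2 + 2 * k x ^+ 2))) (L1D (L1M c2 ih) (L1M c2 ik)).
- by [].
- by apply/measurable_EFinP; exact: measurable_funX.
move=> x _ /=; rewrite lee_fin ger0_norm ?sqr_ge0// ger0_norm.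
  by have := sqr_ge0 (h x - k x); rewrite !expr2; lra.
by rewrite addr_ge0// mulr_ge0// sqr_ge0.
Qed.

Lemma L2_realM a h k : continuous_itv a h -> L2_real a k ->
  L2_real a (fun x => h x * k x).
Proof.
move=> ch /L2_realP[mk ik]; apply/L2_realP; split.
  by apply: measurable_funM => //; exact: continuous_itv_measurable.
by under eq_fun do rewrite exprMn; apply: L1M => //;
  under eq_fun do rewrite expr2; exact: continuous_itvM.
Qed.

Lemma L2_real_continuous a h : continuous_itv a h -> L2_real a h.
Proof.
move=> ch; apply/L2_realP; split; first exact: continuous_itv_measurable.
by under eq_fun do rewrite expr2; apply: continuous_itv_integrable;
  exact: continuous_itvM.
Qed.

Lemma L2_real_L1 a h : L2_real a h -> L1 a h.
Proof.
move=> /L2_realP[mh ih].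
have c1 := continuous_itv_integrable (@continuous_itv_cst R a 1).
apply: (@le_integrable _ _ _ mu _ _ _ (EFin \o (fun x => 1 + h x ^+ 2))) (L1D c1 ih).
- by [].
- exact/measurable_EFinP.
move=> x _ /=; rewrite lee_fin [leRHS]ger0_norm ?addr_ge0 ?sqr_ge0//.
rewrite -(@real_normK _ (h x)) ?num_real//.
by have := sqr_ge0 (`|h x| - 1); have := normr_ge0 (h x); rewrite !expr2; lra.
Qed.

Lemma Rintegral_itv_cst x (c : R) : 0 <= x ->
  \int[mu]_(t in `[0, x]) c = c * x.
Proof.
move=> x0; rewrite Rintegral_cst//; congr (_ * _).
have : fine (mu `[0, x]) = x => //.
rewrite lebesgue_measure_itv/= lte_fin.
by case: ltgtP x0 => //= _ _; rewrite subr0.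
Qed.

(** This is the Cauchy-Schwarz inequality against the constant 1, followed by enlarging [[0, x]] to
    [[0, a]]. *)
Lemma sqr_Rintegral_le a x h : L2_real a h -> x \in `[0, a] ->
  (\int[mu]_(t in `[0, x]) h t) ^+ 2 <= a * \int[mu]_(t in `[0, a]) h t ^+ 2.
Proof.
move=> hL2; have ih := L2_real_L1 hL2; have [mh ih2] := hL2.
rewrite in_itv/= => /andP[x0 xa]; have a0 := le_trans x0 xa.
set m := \int[mu]_(t in _) _.
have I2a : 0 <= \int[mu]_(t in `[0, a]) h t ^+ 2.
  by apply: Rintegral_ge0 => t _; exact: sqr_ge0.
have [x00|xn0] := eqVneq x 0.
  by rewrite /m x00 set_itv1 Rintegral_set1 expr0n mulr_ge0.
have {}x0 : 0 < x by rewrite lt_def xn0.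
apply: (@le_trans _ _ (x * \int[mu]_(t in `[0, x]) h t ^+ 2)); last first.
  apply: ler_pM => //; first exact: ltW.
    by apply: Rintegral_ge0 => t _; exact: sqr_ge0.
  apply: le_Rintegral_itv_sub ih2 _ _ _ _ _ => // [t|]; first exact: sqr_ge0.
  exact: ltW.
(* Since [m] is the integral of [h] over [[0, x]], the integral of [(x h - m)^2] there equals [x]
   times the difference that has to be nonnegative. *)
rewrite -subr_ge0 -(pmulr_rge0 _ x0).
have cx2 := L1M (@continuous_itv_cst R a (x ^+ 2)) ih2.
have cxm := L1M (@continuous_itv_cst R a (- (2 * x * m))) ih.
have cm2 := continuous_itv_integrable (@continuous_itv_cst R a (m ^+ 2)).
have sub k : L1 a k -> mu.-integrable `[0, x] (EFin \o k).
  by move=> ig; exact: integrable_subitv ig _ xa.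
have : 0 <= \int[mu]_(t in `[0, x]) (x * h t - m) ^+ 2.
  by apply: Rintegral_ge0 => t _; exact: sqr_ge0.
rewrite (_ : (fun t => _) =
    (fun t => x ^+ 2 * h t ^+ 2 + (- (2 * x * m) * h t + m ^+ 2))); last first.
  by apply/funext => t; ring.
rewrite RintegralD//; [|exact: sub|exact/sub/L1D].
rewrite RintegralD//; [|exact: sub|exact/sub].
have -> := Rintegral_itv_cst (m ^+ 2) (ltW x0).
rewrite !RintegralZl//; [|exact: (sub _ ih)|exact: (sub _ ih2)].
rewrite -/m.
by congr (_ <= _); ring.
Qed.

Lemma L2D a f g : L2 a f -> L2 a g -> L2 a (fun x => f x + g x).
Proof.
move=> [f1 f2] [g1 g2]; split.
- by under eq_fun do rewrite ReD; exact: L2_realD.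
- by under eq_fun do rewrite ImD; exact: L2_realD.
Qed.

Lemma L2_continuous a f : ccontinuous a f -> L2 a f.
Proof. by move=> [f1 f2]; split; exact: L2_real_continuous. Qed.

Lemma L2M a f g : ccontinuous a f -> L2 a g -> L2 a (fun x => f x * g x).
Proof.
move=> [f1 f2] [g1 g2]; split.
- under eq_fun do rewrite ReM -mulNr; apply: L2_realD; apply: L2_realM => //.
  exact: continuous_itvN.
- by under eq_fun do rewrite ImM; apply: L2_realD; exact: L2_realM.
Qed.

Lemma L2Z a z g : L2 a g -> L2 a (fun x => z * g x).
Proof. by apply: L2M; exact: ccontinuous_cst. Qed.

Lemma L2_CL1 a f : L2 a f -> CL1 a f.
Proof. by move=> [f1 f2]; split; exact: L2_real_L1. Qed.

Lemma eq_L2 a f g : {in `[0, a], f =1 g} -> L2 a f -> L2 a g.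
Proof.
have H h k : {in `[0, a], h =1 k} -> L2_real a h -> L2_real a k.
  move=> hk /L2_realP[mh ih]; apply/L2_realP; split.
    by apply: eq_measurable_fun mh => x /set_mem; exact: hk.
  by apply: eq_integrable ih => // x /set_mem /hk /= ->.
move=> fg [f1 f2]; split.
- by apply: H f1 => x /fg ->.
- by apply: H f2 => x /fg ->.
Qed.

(** The squared modulus as an element of [R]: the norm of [R[i]] takes its values in [R[i]]. *)
Definition sqnormc z : R := Re z ^+ 2 + Im z ^+ 2.

Lemma sqnormc_ge0 z : 0 <= sqnormc z.
Proof. by rewrite addr_ge0// sqr_ge0. Qed.

Lemma sqnormcM z w : sqnormc (z * w) = sqnormc z * sqnormc w.
Proof. by rewrite /sqnormc ReM ImM; ring. Qed.

Lemma sqnormcD_le z w : sqnormc (z + w) <= 2 * (sqnormc z + sqnormc w).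
Proof.
rewrite /sqnormc ReD ImD; have := sqr_ge0 (Re z - Re w).
by have := sqr_ge0 (Im z - Im w); rewrite !expr2; lra.
Qed.

Lemma sqnormc_eq0 z : sqnormc z = 0 -> z = 0.
Proof.
move=> /eqP; rewrite paddr_eq0 ?sqr_ge0// !sqrf_eq0 => /andP[/eqP z1 /eqP z2].
exact: complex_eqP.
Qed.

Definition L2_Rsqnorm a f : R := \int[mu]_(x in `[0, a]) sqnormc (f x).

Lemma L2_Rsqnorm_ge0 a f : 0 <= L2_Rsqnorm a f.
Proof. by apply: Rintegral_ge0 => x _; exact: sqnormc_ge0. Qed.

Lemma L2_sqnormc a f : L2 a f -> L1 a (fun x => sqnormc (f x)).
Proof. by move=> [/L2_realP[_ f1] /L2_realP[_ f2]]; exact: L1D. Qed.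

Lemma L2_sqnormE a f : L2 a f -> L2_sqnorm a f = (L2_Rsqnorm a f)%:E.
Proof.
move=> /L2_sqnormc fL; rewrite /L2_Rsqnorm /Rintegral fineK//.
exact: integrable_fin_num fL.
Qed.

Lemma ccontinuous_sqnormc_bounded a f : ccontinuous a f ->
  exists M, 0 <= M /\ forall x, x \in `[0, a] -> sqnormc (f x) <= M.
Proof.
move=> [f1 f2].
have [M1 [M10 H1]] := continuous_itv_bounded (continuous_itvM f1 f1).
have [M2 [M20 H2]] := continuous_itv_bounded (continuous_itvM f2 f2).
exists (M1 + M2); split=> [|x xa]; first exact: addr_ge0.
rewrite /sqnormc !expr2; apply: lerD.
- exact: le_trans (ler_norm _) (H1 x xa).
- exact: le_trans (ler_norm _) (H2 x xa).
Qed.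

(** The constant depends on neither [f] nor [x]; this uniformity is what makes Green's formula an
    estimate for the resolvent. It comes from Cauchy-Schwarz and the boundedness of [u]. *)
Lemma sqnormc_Cintegral_le a u : 0 <= a -> ccontinuous a u ->
  exists M, 0 <= M /\ forall f x, L2 a f -> x \in `[0, a] ->
    sqnormc (Cintegral `[0, x] (fun t => u t * f t)) <= M * L2_Rsqnorm a f.
Proof.
move=> a0 cu; have [M [M0 uM]] := ccontinuous_sqnormc_bounded cu.
exists (a * M); split=> [|f x fL xa]; first exact: mulr_ge0.
have uf := L2M cu fL; have [uf1 uf2] := uf.
have := sqr_Rintegral_le uf1 xa; have := sqr_Rintegral_le uf2 xa.
rewrite [sqnormc _]/sqnormc /= => H2 H1; apply: le_trans (lerD H1 H2) _.
rewrite -mulrDr -RintegralD//; [|exact: uf1.2|exact: uf2.2].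
rewrite -mulrA; apply: ler_wpM2l => //; rewrite -RintegralZl//; last first.
  exact: L2_sqnormc.
apply: le_Rintegral => //.
- exact: (L2_sqnormc uf).
- exact: (L1M (@continuous_itv_cst R a M) (L2_sqnormc fL)).
move=> t /= ta; rewrite -/(sqnormc (u t * f t)) sqnormcM.
by apply: ler_wpM2r; [exact: sqnormc_ge0|exact: uM].
Qed.

Lemma L2_sqnorm_eq0 a f : 0 < a -> ccontinuous a f -> L2_sqnorm a f = 0 ->
  forall x, x \in `[0, a] -> f x = 0.
Proof.
move=> a0 cf; have fL := L2_continuous cf; have [f1 f2] := cf.
rewrite L2_sqnormE// => -[N0] x xa; apply: sqnormc_eq0.
apply: (ge0_continuous_itv_eq0 a0 _ _ N0 xa) => [|t]; last exact: sqnormc_ge0.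
by apply: continuous_itvD; under eq_fun do rewrite expr2; exact: continuous_itvM.
Qed.

Lemma L2_sqnorm_le a f M : 0 <= a -> 0 <= M -> L2 a f ->
  (forall x, x \in `[0, a] -> sqnormc (f x) <= M) -> L2_Rsqnorm a f <= a * M.
Proof.
move=> a0 M0 fL fM.
have -> : a * M = \int[mu]_(x in `[0, a]) M.
  by rewrite Rintegral_itv_cst// mulrC.
apply: le_Rintegral => //.
- exact: L2_sqnormc.
- exact: continuous_itv_integrable (@continuous_itv_cst R a M).
Qed.

End square_integrable.

(** * The inhomogeneous equation on an edge *)

Section edge.
Context {R : realType}.
Local Notation mu := (@lebesgue_measure R).
Local Notation Re := complex.Re.
Local Notation Im := complex.Im.
Variables (a : R) (q : R -> R) (lam : R[i]).
Hypotheses (a_gt0 : 0 < a) (q_L2 : L2_real a q).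
Implicit Types (f u y : R -> R[i]).

Let a_ge0 : 0 <= a. Proof. exact: ltW. Qed.
Let a_itv : a \in `[0, a]. Proof. by rewrite in_itv/= lexx a_ge0. Qed.

Definition potential x : R[i] := (q x)%:C - lam.

(* y is a solution of - y'' + q y = lam y + f, with derivative y1. *)
Definition helmholtz y y1 f :=
  weak_derivative a y y1 /\
  weak_derivative a y1 (fun x => potential x * y x - f x).

Lemma L2_potentialM y : ccontinuous a y -> L2 a (fun x => potential x * y x).
Proof.
move=> cy; have qL : L2 a (fun x => (q x)%:C).
  by split=> //=; exact/L2_real_continuous/continuous_itv_cst.
have := L2M cy (L2D qL (L2_continuous (ccontinuous_cst a (- lam)))).
by congr L2; apply/funext => x; rewrite mulrC.
Qed.

Lemma L2_helmholtz y f : ccontinuous a y -> L2 a f ->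
  L2 a (fun x => potential x * y x - f x).
Proof.
move=> cy fL; have := L2D (L2_potentialM cy) (L2Z (-1) fL).
by congr L2; apply/funext => x; rewrite mulN1r.
Qed.

Lemma helmholtz_continuous y y1 f : helmholtz y y1 f -> ccontinuous a y.
Proof. by move=> [dy _]; exact: weak_derivative_continuous dy. Qed.

Lemma helmholtz_continuous1 y y1 f : helmholtz y y1 f -> ccontinuous a y1.
Proof. by move=> [_ dy]; exact: weak_derivative_continuous dy. Qed.

Lemma helmholtzZ z y y1 f : helmholtz y y1 f ->
  helmholtz (fun x => z * y x) (fun x => z * y1 x) (fun x => z * f x).
Proof.
move=> [dy dy1]; split; first exact: weak_derivativeZ.
have := weak_derivativeZ z a_ge0 dy1.
by congr weak_derivative; apply/funext => x; ring.
Qed.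

(** Evenness of [q] enters here: the reflected function solves the equation with potential
    [q (a - x)], which is [q x] almost everywhere. *)
Lemma helmholtz_reflect y y1 : even_potential a q -> helmholtz y y1 (fun=> 0) ->
  helmholtz (fun x => y (a - x)) (fun x => - y1 (a - x)) (fun=> 0).
Proof.
move=> qe hy; have [dy dy1] := hy; split; first exact: weak_derivative_reflect.
have dyr := weak_derivative_reflect a_ge0 dy.
have cyr := weak_derivative_continuous a_ge0 dyr.
have := weak_derivativeZ (-1) a_ge0 (weak_derivative_reflect a_ge0 dy1).
rewrite (_ : (fun x => -1 * y1 (a - x)) = (fun x => - y1 (a - x))); last first.
  by apply/funext => x; rewrite mulN1r.
apply: ae_weak_derivative.
  exact/L2_CL1/L2_helmholtz/L2_continuous/ccontinuous_cst.
apply: aeS qe => x qx xa; rewrite mulN1r opprK !subr0.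
by rewrite /potential qx.
Qed.

Lemma solves_schrodinger_helmholtz y y1 : solves_schrodinger a q lam y y1 ->
  helmholtz y y1 (fun=> 0).
Proof.
move=> [y2 [[dy dy1 y2L] eqn]]; split=> //.
have cy := weak_derivative_continuous a_ge0 dy.
apply: ae_weak_derivative dy1.
  exact/L2_CL1/L2_helmholtz/L2_continuous/ccontinuous_cst.
apply: aeS eqn => x H /H E; rewrite subr0 /potential mulrBl -E.
by rewrite opprD opprK addrCA subrr addr0.
Qed.

(** In the derivative of the Wronskian of [y] and [u] the potential terms cancel and only the source
    remains; for [f = 0] the Wronskian is constant. *)
Lemma lagrange_identity y y1 f u u1 :
  helmholtz y y1 f -> helmholtz u u1 (fun=> 0) ->
  weak_derivative a (fun x => y x * u1 x - y1 x * u x) (fun x => u x * f x).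
Proof.
move=> [dy dy1] [du du1].
have := weak_derivativeB a_ge0 (weak_derivativeM a_ge0 dy du1)
  (weak_derivativeM a_ge0 dy1 du).
by congr weak_derivative; apply/funext => x; ring.
Qed.

Section green.
Variables (S S1 T T1 : R -> R[i]).
Hypotheses (hS : helmholtz S S1 (fun=> 0)) (hT : helmholtz T T1 (fun=> 0)).
Hypotheses (S_0 : S 0 = 0) (S1_0 : S1 0 = 1) (T_a : T a = 0) (T1_a : T1 a = -1).
Hypotheses (T_0 : T 0 = S a) (T1_0 : T1 0 = - S1 a).

Let cS : ccontinuous a S. Proof. exact: helmholtz_continuous hS. Qed.
Let cT : ccontinuous a T. Proof. exact: helmholtz_continuous hT. Qed.

Lemma Cintegral_mulr0 x (u : R -> R[i]) :
  Cintegral `[0, x] (fun t => u t * 0) = 0.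
Proof.
rewrite (_ : (fun t => _) = (fun=> 0)); last by apply/funext => t; rewrite mulr0.
by apply: complex_eqP; rewrite /= Rintegral_cst// mul0r.
Qed.

Lemma wronskian x : x \in `[0, a] -> T x * S1 x - T1 x * S x = S a.
Proof.
move=> xa; have [_ ->//] := lagrange_identity hT hS.
by rewrite S_0 S1_0 T_0 mulr1 mulr0 subr0 Cintegral_mulr0 addr0.
Qed.

Definition left_moment f x := Cintegral `[0, x] (fun t => S t * f t).
Definition right_moment f x := Cintegral `[0, x] (fun t => T t * f t).

(* With (U, V) = (S, T) this is the solution with boundary values al and be, and
   with (U, V) = (S1, T1) its derivative. *)
Definition green f (al be : R[i]) (U V : R -> R[i]) x :=
  ((al + left_moment f x) * V x
   + (be + right_moment f a - right_moment f x) * U x) / S a.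

Lemma moment0 u f : Cintegral `[0, 0] (fun t => u t * f t) = 0.
Proof. by apply: complex_eqP; rewrite /= set_itv1 Rintegral_set1. Qed.

(** Lagrange's identity against [S] and against [T] gives two linear equations for [y x] and [y1 x];
    their determinant is the Wronskian, which equals [S a]. *)
Lemma greenE y y1 f x : S a != 0 -> helmholtz y y1 f -> x \in `[0, a] ->
  y x = green f (y 0) (y a) S T x /\ y1 x = green f (y 0) (y a) S1 T1 x.
Proof.
move=> Sa0 hy xa.
have [_ WS] := lagrange_identity hy hS; have [_ WT] := lagrange_identity hy hT.
have := WT _ a_itv; rewrite T_a T1_a mulr0 subr0 mulrN1 -/(right_moment f a).
move: (WS _ xa) (WT _ xa).
rewrite -/(right_moment f x) -/(left_moment f x) S_0 S1_0 mulr0 subr0 mulr1.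
set w := y 0 * T1 0 - _ => ES ET Ew.
(* The constant [w] contains the unknown [y1 0]; the identity for [T] at [x = a] expresses it
   through the boundary value [y a]. *)
have -> : y a = - (w + right_moment f a) by rewrite -Ew opprK.
have W := wronskian xa.
split; apply: (mulIf Sa0); rewrite /green mulfVK//.
- have -> : y 0 + left_moment f x = y x * S1 x - y1 x * S x by rewrite ES.
  have -> : - (w + right_moment f a) + right_moment f a - right_moment f x =
    - (y x * T1 x - y1 x * T x) by rewrite ET; ring.
  by rewrite -W; ring.
- have -> : y 0 + left_moment f x = y x * S1 x - y1 x * S x by rewrite ES.
  have -> : - (w + right_moment f a) + right_moment f a - right_moment f x =
    - (y x * T1 x - y1 x * T x) by rewrite ET; ring.
  by rewrite -W; ring.
Qed.

Lemma green_0 f al be U V :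
  green f al be U V 0 = (al * V 0 + (be + right_moment f a) * U 0) / S a.
Proof.
by rewrite /green /left_moment [X in _ - X]moment0 moment0; congr (_ / _); ring.
Qed.

Lemma green_a f al be U V :
  green f al be U V a = ((al + left_moment f a) * V a + be * U a) / S a.
Proof. by rewrite /green addrK. Qed.

(** Variation of constants: the coefficients of [T] and [S] have derivatives [S f] and [- T f],
    whose contributions cancel in the first derivative and produce minus the Wronskian times [f] in
    the second. *)
Lemma green_helmholtz f al be : S a != 0 -> L2 a f ->
  helmholtz (green f al be S T) (green f al be S1 T1) f.
Proof.
move=> Sa0 fL.
have dl : weak_derivative a (fun x => al + left_moment f x) (fun x => S x * f x).
  exact: weak_derivative_primitive a_ge0 (L2_CL1 (L2M cS fL)).
have dr : weak_derivative a (fun x => be + right_moment f a - right_moment f x)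
    (fun x => - (T x * f x)).
  have := weak_derivativeB a_ge0 (weak_derivative_cst a (be + right_moment f a))
    (weak_derivative_primitive 0 a_ge0 (L2_CL1 (L2M cT fL))).
  by congr weak_derivative; apply/funext => x; rewrite add0r.
have [dS dS1] := hS; have [dT dT1] := hT.
have dyg := weak_derivativeZ (S a)^-1 a_ge0 (weak_derivativeD
  (weak_derivativeM a_ge0 dl dT) (weak_derivativeM a_ge0 dr dS)).
have dy1g := weak_derivativeZ (S a)^-1 a_ge0 (weak_derivativeD
  (weak_derivativeM a_ge0 dl dT1) (weak_derivativeM a_ge0 dr dS1)).
have dy : weak_derivative a (green f al be S T) (green f al be S1 T1).
  by move: dyg; congr weak_derivative; apply/funext => x; rewrite /green; ring.
split=> //.
have cy := weak_derivative_continuous a_ge0 dy.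
(* The product rule yields [f] with the factor Wronskian over [S a], which is 1 on [[0, a]]. *)
apply: (@ae_weak_derivative _ _ _ (fun x => potential x * green f al be S T x
  - (T x * S1 x - T1 x * S x) / S a * f x)).
- exact/L2_CL1/L2_helmholtz.
- by apply: aeW => x xa; rewrite wronskian// divff// mul1r.
move: dy1g; congr weak_derivative; apply/funext => x; rewrite /green; ring.
Qed.

End green.

End edge.

(** * Bloch functions on a periodic graph *)

Section square_bounded.
Context {R : realType} {D : Type}.
Variables (V : D -> Prop) (N : D -> R).
Implicit Types phi psi : D -> R[i].

(** Stability of this bound under sums and bounded multipliers lets the solution formula be
    estimated term by term, without tracking constants. *)
Definition square_bounded phi :=
  exists C, 0 <= C /\ forall d, V d -> sqnormc (phi d) <= C * N d.

Lemma square_boundedD phi psi : square_bounded phi -> square_bounded psi ->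
  square_bounded (fun d => phi d + psi d).
Proof.
move=> [C [C0 HC]] [C' [C'0 HC']]; exists (2 * (C + C')); split=> [|d Vd].
  by rewrite mulr_ge0// addr_ge0.
apply: le_trans (sqnormcD_le _ _) _; rewrite -mulrA ler_pM2l// mulrDl.
by apply: lerD; [exact: HC|exact: HC'].
Qed.

Lemma square_boundedM (M : R) psi phi : (forall d, V d -> sqnormc (psi d) <= M) ->
  square_bounded phi -> square_bounded (fun d => psi d * phi d).
Proof.
move=> HM [C [C0 HC]]; exists (`|M| * C); split=> [|d Vd]; first exact: mulr_ge0.
rewrite sqnormcM -mulrA; apply: ler_pM; rewrite ?sqnormc_ge0//; last exact: HC.
exact: le_trans (HM _ Vd) (ler_norm _).
Qed.

Lemma square_boundedZ (z : R[i]) phi : square_bounded phi ->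
  square_bounded (fun d => z * phi d).
Proof. exact: (@square_boundedM (sqnormc z)). Qed.

Lemma square_bounded_sum (I : Type) (r : seq I) (P : pred I) (phi : I -> D -> R[i]) :
  (forall i, square_bounded (phi i)) ->
  square_bounded (fun d => \sum_(i <- r | P i) phi i d).
Proof.
move=> Hphi; elim: r => [|i r IHr].
  exists 0; split=> // d Vd; rewrite big_nil mul0r /sqnormc /= expr0n/=.
  by rewrite addr0.
have : square_bounded (fun d =>
    (if P i then phi i d else 0) + \sum_(i <- r | P i) phi i d).
  apply: square_boundedD => //; case: (P i) => //.
  by exists 0; split=> // d Vd; rewrite mul0r /sqnormc /= expr0n/= addr0.
congr square_bounded; apply/funext => d; rewrite big_cons.
by case: (P i); rewrite ?add0r.
Qed.

End square_bounded.

Section phase.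
Context {R : realType}.

Lemma expiD (x y : R) : expi (x + y) = expi x * expi y.
Proof. by apply: complex_eqP; rewrite ?ReM ?ImM /= ?cosD ?sinD//; ring. Qed.

Lemma expi0 : expi (0 : R) = 1.
Proof. by rewrite /expi cos0 sin0. Qed.

Definition phase (th1 th2 : R) (p : int * int) : R[i] :=
  expi (p.1%:~R * th1 + p.2%:~R * th2).

Lemma phaseD th1 th2 p r :
  phase th1 th2 (p + r) = phase th1 th2 p * phase th1 th2 r.
Proof. by rewrite /phase -expiD /= !intrD; congr expi; ring. Qed.

Lemma phase0 th1 th2 : phase th1 th2 0 = 1.
Proof. by rewrite /phase /= !mul0r addr0 expi0. Qed.

Lemma phaseNr th1 th2 p : phase th1 th2 (- p) * phase th1 th2 p = 1.
Proof. by rewrite -phaseD addNr phase0. Qed.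

End phase.

(** * Reduction to a fundamental domain *)

Section graph.
Context {R : realType}.
Variables (G : periodic_graph) (a : R) (q : R -> R) (lam : R[i]) (th1 th2 : R).
Hypotheses (a_gt0 : 0 < a) (q_L2 : L2_real a q).
Implicit Types (y z : graph_function R G) (F Y : 'I_(nedge G) -> R -> R[i]).
Implicit Types (U : 'I_(nvertex G) -> R[i]) (e : 'I_(nedge G)).

Local Notation phase := (phase th1 th2).
Local Notation tl e := (tail e).1.
Local Notation hd e := (head e).1.
Local Notation tlp e := (tail e).2.
Local Notation hdp e := (head e).2.
Local Notation helmholtz := (helmholtz a q lam).

Let a_ge0 : 0 <= a. Proof. exact: ltW. Qed.
Let zero_itv : 0 \in `[0, a]. Proof. by rewrite in_itv/= lexx. Qed.
Let a_itv : a \in `[0, a]. Proof. by rewrite in_itv/= lexx a_ge0. Qed.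

(* The data of H^Theta restricted to a fundamental domain: the representative
   edges carry Y, and U gives the values at the representative vertices. *)
Definition fundamental_solution Y (Y1 : 'I_(nedge G) -> R -> R[i]) F U :=
  [/\ forall e, helmholtz (Y e) (Y1 e) (F e),
      forall e, L2 a (F e),
      forall e, Y e 0 = phase (tlp e) * U (tl e) /\
                Y e a = phase (hdp e) * U (hd e) &
      forall v, \sum_(e | tl e == v) phase (- tlp e) * Y1 e 0 -
                \sum_(e | hd e == v) phase (- hdp e) * Y1 e a = 0].

Lemma bloch_fundamental y z : bloch_hamiltonian a q th1 th2 y z ->
  exists Y1 U, fundamental_solution (fun e => y e 0) Y1
    (fun e x => z e 0 x - lam * y e 0 x) U.
Proof.
move=> [y1 [y2 [Hs [u Hu] Hk Hf Hz]]].
have Hy e p x : x \in `[0, a] -> y e p x = phase p * y e 0 x.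
  by move=> xa; have := Hf e 0 p x xa; rewrite add0r.
have Hy1 e p : {in `[0, a], y1 e p =1 (fun x => phase p * y1 e 0 x)}.
  have [d0 d1 _] := Hs e p; have [d0' d1' _] := Hs e 0.
  apply: (weak_derivative_unique a_gt0 _ _ d0
    (weak_derivativeZ (phase p) a_ge0 d0')) => [||x xa].
  - exact: weak_derivative_continuous d1.
  - exact: weak_derivative_continuous (weak_derivativeZ _ a_ge0 d1').
  - exact: Hy.
exists (fun e => y1 e 0), (fun v => u v 0).
have E e x : x \in `[0, a] ->
    y2 e 0 x = potential q lam x * y e 0 x - (z e 0 x - lam * y e 0 x).
  by move=> xa; rewrite Hz// /potential; ring.
split.
- move=> e; have [d0 d1 L] := Hs e 0; split=> //.
  apply: ae_weak_derivative d1; last by apply: aeW => x; exact: E.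
  by apply: L2_CL1; apply: eq_L2 L => x; exact: E.
- move=> e; have [d0 d1 L] := Hs e 0.
  have cy := weak_derivative_continuous a_ge0 d0.
  have := L2_helmholtz lam q_L2 cy L; apply: eq_L2 => x xa.
  by rewrite E//; ring.
- move=> e; split.
    (* The translate of [e] by [- tlp e] starts in cell 0, where the vertex values [U] are read off;
       the next case does the same for final endpoints. *)
    have := (Hu e (- tlp e)).1; rewrite addrN Hy// => <-.
    by rewrite mulrA [phase _ * _]mulrC phaseNr mul1r.
  have := (Hu e (- hdp e)).2; rewrite addrN Hy// => <-.
  by rewrite mulrA [phase _ * _]mulrC phaseNr mul1r.
- move=> v; rewrite -[RHS](Hk v 0); congr (_ - _); apply: eq_bigr => e _.
    by rewrite sub0r [RHS]Hy1.
  by rewrite sub0r [RHS]Hy1.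
Qed.

Lemma fundamental_bloch Y (Y1 : 'I_(nedge G) -> R -> R[i]) F U z :
  fundamental_solution Y Y1 F U ->
  (forall e p x, x \in `[0, a] -> z e p x = phase p * (lam * Y e x + F e x)) ->
  bloch_hamiltonian a q th1 th2 (fun e p x => phase p * Y e x) z.
Proof.
move=> [hY FL HU HK] Hz.
exists (fun e p x => phase p * Y1 e x).
exists (fun e p x => phase p * (potential q lam x * Y e x - F e x)).
split.
- move=> e p; have [d d1] := hY e; split.
  + exact: weak_derivativeZ.
  + exact: weak_derivativeZ.
  + by apply: L2Z; apply: L2_helmholtz => //; exact: helmholtz_continuous (hY e).
- exists (fun v r => phase r * U v) => e p; have [-> ->] := HU e.
  by rewrite !phaseD; split; ring.
(* The Kirchhoff sum at the vertex [(v, r)] is [phase r] times the one in cell 0. *)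
- move=> v r; apply: etrans (mulr0 (phase r)).
  rewrite -[X in _ = _ * X](HK v) mulrBr !mulr_sumr.
  by congr (_ - _); apply: eq_bigr => e _; rewrite phaseD; ring.
- by move=> e r p x xa; rewrite phaseD -/(phase p); ring.
- by move=> e p x xa; rewrite Hz// /potential; ring.
Qed.

Lemma bloch_sqnorm_ge0 y : (0 <= bloch_sqnorm a y)%E.
Proof.
apply: sume_ge0 => e _; apply: integral_ge0 => x _.
by rewrite lee_fin; exact: sqnormc_ge0.
Qed.

(** For an eigenfunction the right-hand side of the resolvent estimate is 0, so its norm vanishes;
    being continuous on each edge, it is then 0 everywhere. *)
Lemma eigenfunction_spectrum Y (Y1 : 'I_(nedge G) -> R -> R[i]) U e x :
  fundamental_solution Y Y1 (fun _ _ => 0) U -> x \in `[0, a] -> Y e x != 0 ->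
  bloch_spectrum G a q th1 th2 lam.
Proof.
move=> HF xa /eqP Yn0 [_ [C HC]]; apply: Yn0.
pose z : graph_function R G := fun e p x => phase p * (lam * Y e x + 0).
have Hz : bloch_hamiltonian a q th1 th2 (fun e p x => phase p * Y e x) z.
  exact: fundamental_bloch HF _.
have {Hz HC} H := HC _ _ Hz.
have E0 : bloch_sqnorm a (fun e p x => z e p x - lam * (phase p * Y e x)) = 0%E.
  apply: big1 => e' _; apply: integral0_eq => t _.
  by rewrite /z addr0 mulrCA subrr /= expr0n/= addr0.
move: H; rewrite {}E0 mule0 => H.
have {}H : bloch_sqnorm a (fun e p x => phase p * Y e x) = 0%E.
  by apply/eqP; rewrite eq_le H bloch_sqnorm_ge0.
have H' : L2_sqnorm a (fun x => phase 0 * Y e x) = 0%E.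
  have L_ge0 e' : (0%E <= L2_sqnorm a (fun x => phase 0%R * Y e' x)%R)%E.
    by apply: integral_ge0 => t _; rewrite lee_fin; exact: sqnormc_ge0.
  apply/eqP; rewrite eq_le L_ge0 andbT -H /bloch_sqnorm (bigD1 e)//=.
  by rewrite leeDl// sume_ge0.
have := L2_sqnorm_eq0 a_gt0 _ H' xa; rewrite phase0 mul1r; apply.
apply: ccontinuousM; first exact: ccontinuous_cst.
by case: HF => hY _ _ _; exact: helmholtz_continuous (hY e).
Qed.

End graph.

(** * The linear system for the vertex values *)

Section floquet_matrix.
Context {R : realType}.
Variables (G : periodic_graph) (th1 th2 : R).
Local Notation phase := (phase th1 th2).
Local Notation tl e := (tail e).1.
Local Notation hd e := (head e).1.
Local Notation tlp e := (tail e).2.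
Local Notation hdp e := (head e).2.

(* A row vector of vertex values times this matrix is S(a) times the Kirchhoff
   sums of the solutions of - y'' + q y = lam y with these vertex values, where
   s = S'(a): it is the phase-weighted adjacency matrix minus s times the
   diagonal matrix of vertex degrees. *)
Definition floquet_matrix (s : R[i]) : 'M[R[i]]_(nvertex G) :=
  \matrix_(w, v) (\sum_(e : 'I_(nedge G) | tl e == v)
      (phase (hdp e - tlp e) * (hd e == w)%:R - s * (v == w)%:R) +
    \sum_(e : 'I_(nedge G) | hd e == v)
      (phase (tlp e - hdp e) * (tl e == w)%:R - s * (v == w)%:R)).

Lemma sum_mulr_delta n (X : 'I_n -> R[i]) i : \sum_w X w * (i == w)%:R = X i.
Proof.
rewrite (bigD1 i)//= eqxx mulr1 big1 ?addr0// => w /negbTE wi.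
by rewrite eq_sym wi mulr0.
Qed.

Lemma mul_floquet_matrixE s (U : 'rV[R[i]]_(nvertex G)) v :
  (U *m floquet_matrix s) 0 v =
  \sum_(e : 'I_(nedge G) | tl e == v)
    (phase (hdp e - tlp e) * U 0 (hd e) - s * U 0 v) +
  \sum_(e : 'I_(nedge G) | hd e == v)
    (phase (tlp e - hdp e) * U 0 (tl e) - s * U 0 v).
Proof.
rewrite mxE; under eq_bigr do rewrite mxE mulrDr !mulr_sumr.
rewrite big_split/= exchange_big/= [X in _ + X]exchange_big/=.
have H c i : \sum_w U 0 w * (c * (i == w)%:R - s * (v == w)%:R) =
    c * U 0 i - s * U 0 v.
  rewrite -(sum_mulr_delta (U 0) i) -(sum_mulr_delta (U 0) v).
  rewrite !mulr_sumr -sumrB; apply: eq_bigr => w _; ring.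
by congr (_ + _); apply: eq_bigr => e _; rewrite H.
Qed.

End floquet_matrix.

(** * The spectral criterion for a general periodic graph *)

Section spectrum.
Context {R : realType}.
Variables (G : periodic_graph) (a : R) (q : R -> R) (lam : R[i]) (th1 th2 : R).
Hypotheses (a_gt0 : 0 < a) (q_L2 : L2_real a q) (q_even : even_potential a q).
Variables (S S1 : R -> R[i]).
Hypotheses (hS : helmholtz a q lam S S1 (fun=> 0)) (S_0 : S 0 = 0) (S1_0 : S1 0 = 1).
Implicit Types (y z : graph_function R G) (F Y : 'I_(nedge G) -> R -> R[i]).
Implicit Types (e : 'I_(nedge G)) (v : 'I_(nvertex G)).

Local Notation phase := (phase th1 th2).
Local Notation tl e := (tail e).1.
Local Notation hd e := (head e).1.
Local Notation tlp e := (tail e).2.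
Local Notation hdp e := (head e).2.
Local Notation spectrum := (bloch_spectrum G a q th1 th2 lam).
Local Notation fmatrix := (floquet_matrix G th1 th2 (S1 a)).
Local Notation fundamental := (fundamental_solution a q lam th1 th2).

Let T x := S (a - x).
Let T1 x := - S1 (a - x).

Let a_ge0 : 0 <= a. Proof. exact: ltW. Qed.
Let zero_itv : 0 \in `[0, a]. Proof. by rewrite in_itv/= lexx. Qed.
Let a_itv : a \in `[0, a]. Proof. by rewrite in_itv/= lexx a_ge0. Qed.
Let hT : helmholtz a q lam T T1 (fun=> 0).
Proof. exact: helmholtz_reflect. Qed.
Let T_0 : T 0 = S a. Proof. by rewrite /T subr0. Qed.
Let T1_0 : T1 0 = - S1 a. Proof. by rewrite /T1 subr0. Qed.
Let T_a : T a = 0. Proof. by rewrite /T subrr. Qed.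
Let T1_a : T1 a = -1. Proof. by rewrite /T1 subrr S1_0. Qed.
Let cS : ccontinuous a S. Proof. exact: helmholtz_continuous hS. Qed.
Let cT : ccontinuous a T. Proof. exact: helmholtz_continuous hT. Qed.

Lemma S_a_eq0_spectrum : (nvertex G < nedge G)%N -> S a = 0 -> spectrum.
Proof.
move=> VE Sa0.
(* Row [e] of [B] lists the contributions of [S] on the edge [e] to the Kirchhoff sums at the
   vertices, so a left kernel vector gives admissible edge amplitudes. *)
pose B : 'M[R[i]]_(nedge G, nvertex G) := \matrix_(e, v)
  ((tl e == v)%:R * phase (- tlp e) - (hd e == v)%:R * phase (- hdp e) * S1 a).
have [c cn0 cB] : exists2 c : 'rV[R[i]]_(nedge G), c != 0 & c *m B = 0.
  have /rowV0Pn[c cK cn0] : kermx B != 0.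
    (* A trivial kernel would force the rank of [B] to be the number of edges, which exceeds the
       number of columns. *)
    rewrite kermx_eq0 /row_free; apply/eqP => rB.
    by have := rank_leq_col B; rewrite rB leqNgt VE.
  by exists c => //; apply/sub_kermxP.
have [e ce] : exists e, c 0 e != 0.
  apply/existsP; move: cn0; apply: contraNT; rewrite negb_exists => /forallP H.
  by apply/eqP/rowP => e; rewrite mxE; apply/eqP; have := H e; rewrite negbK.
have HF : fundamental (fun e x => c 0 e * S x) (fun e x => c 0 e * S1 x)
    (fun _ _ => 0) (fun=> 0).
  split.
  - move=> e'; have := helmholtzZ a_gt0 (c 0 e') hS.
    by congr helmholtz; apply/funext => x; rewrite mulr0.
  - by move=> _; exact/L2_continuous/ccontinuous_cst.
  - by move=> e'; rewrite S_0 Sa0 !mulr0.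
  move=> v; have := congr1 (fun M : 'rV__ => M 0 v) cB; rewrite !mxE => cBv.
  apply: etrans cBv.
  rewrite big_mkcond [X in _ - X]big_mkcond -sumrB; apply: eq_bigr => e' _.
  by rewrite mxE S1_0; case: (tl e' == v); case: (hd e' == v); rewrite /=; ring.
have [x xa Sx] : exists2 x, x \in `[0, a] & S x <> 0.
  apply: contrapT => H; have S0 x : x \in `[0, a] -> S x = 0.
    by move=> xa; apply: contrapT => Sx; apply: H; exists x.
  have cS1 := helmholtz_continuous1 a_gt0 hS.
  have := weak_derivative0_eq0 a_gt0 cS1 hS.1 S0 zero_itv.
  by rewrite S1_0 => /eqP; rewrite oner_eq0.
apply: (eigenfunction_spectrum a_gt0 q_L2 HF xa (e := e)).
by rewrite mulf_neq0//; exact/eqP.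
Qed.

Section S_a_neq0.
Hypothesis Sa0 : S a != 0.

Let gr F (U : 'rV[R[i]]_(nvertex G)) e V W x :=
  green a S T (F e) (phase (tlp e) * U 0 (tl e)) (phase (hdp e) * U 0 (hd e)) V W x.

(** This is [S a] times the part of the Kirchhoff sums due to the source. Both moments enter with a
    plus sign: at final endpoints [T1 a = -1] compensates the sign of the outward derivative. *)
Definition source F : 'rV[R[i]]_(nvertex G) :=
  \row_v (\sum_(e | tl e == v) phase (- tlp e) * right_moment T (F e) a +
          \sum_(e | hd e == v) phase (- hdp e) * left_moment S (F e) a).

Lemma kirchhoff_green F (U : 'rV[R[i]]_(nvertex G)) v :
  \sum_(e | tl e == v) phase (- tlp e) * gr F U e S1 T1 0 -
  \sum_(e | hd e == v) phase (- hdp e) * gr F U e S1 T1 a =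
  (U *m fmatrix + source F) 0 v / S a.
Proof.
rewrite mxE mul_floquet_matrixE mxE addrACA -!big_split/= mulrDl !mulr_suml.
rewrite -sumrN; congr (_ + _); last first.
  apply: eq_bigr => e /eqP ev.
  rewrite /gr green_a T1_a -ev phaseD.
  have := phaseNr th1 th2 (hdp e); set p := phase (- _); set r := phase _ => pr.
  set w := phase _; set U1 := U _ _; set U2 := U _ _.
  (* The factor 1 in the diagonal term is written as a product of inverse phases, a relation that
     [ring] cannot supply. *)
  rewrite -[S1 a * U2]mul1r -[X in X * (S1 a * U2)]pr; ring.
apply: eq_bigr => e /eqP ev.
rewrite /gr green_0 T1_0 S1_0 -ev phaseD.
have := phaseNr th1 th2 (tlp e); set p := phase (- _); set r := phase _ => pr.
set w := phase _; set U1 := U _ _; set U2 := U _ _.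
rewrite -[S1 a * U1]mul1r -[X in X * (S1 a * U1)]pr; ring.
Qed.

Lemma green_fundamental F (U : 'rV[R[i]]_(nvertex G)) :
  (forall e, L2 a (F e)) -> U *m fmatrix + source F = 0 ->
  fundamental (fun e => gr F U e S T) (fun e => gr F U e S1 T1) F (fun v => U 0 v).
Proof.
move=> FL UF; split=> //.
- by move=> e; apply: (green_helmholtz a_gt0 q_L2 hS hT).
- move=> e; rewrite /gr green_0 green_a S_0 T_0 T_a !mulr0 addr0 add0r.
  by rewrite !mulfK.
- by move=> v; rewrite kirchhoff_green UF mxE mul0r.
Qed.

(** Converse of [green_fundamental]: when [S a] is nonzero, solving on the graph amounts to solving
    the finite linear system for [U]. *)
Lemma fundamental_green Y Y1 F (U : 'rV[R[i]]_(nvertex G)) :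
  fundamental Y Y1 F (fun v => U 0 v) ->
  U *m fmatrix + source F = 0 /\
  forall e x, x \in `[0, a] -> Y e x = gr F U e S T x.
Proof.
move=> [hY FL YU HK].
have E e x : x \in `[0, a] -> Y e x = gr F U e S T x /\ Y1 e x = gr F U e S1 T1 x.
  move=> xa; rewrite /gr -(YU e).1 -(YU e).2.
  exact: (greenE a_gt0 hS hT).
split=> [|e x xa]; last exact: (E e x xa).1.
apply/rowP => v; apply: (mulIf (invr_neq0 Sa0)).
rewrite -kirchhoff_green [in RHS]mxE mul0r -[RHS](HK v).
by congr (_ - _); apply: eq_bigr => e _; rewrite (E e _ _).2.
Qed.

(** A kernel vector is turned into vertex values of a solution. As every vertex class meets an edge,
    its nonzero entry appears, up to a phase, as an endpoint value, so the solution is nonzero. *)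
Lemma det_eq0_spectrum : (forall v, exists e, (tl e == v) || (hd e == v)) ->
  \det fmatrix = 0 -> spectrum.
Proof.
move=> Hv /eqP/det0P[U Un0 UM].
have [v Uv] : exists v, U 0 v != 0.
  apply/existsP; move: Un0; apply: contraNT; rewrite negb_exists => /forallP H.
  by apply/eqP/rowP => v; rewrite mxE; apply/eqP; have := H v; rewrite negbK.
have F0 : source (fun _ _ => 0) = 0.
  apply/rowP => v'; rewrite !mxE !big1 ?addr0// => e _.
    by rewrite /left_moment Cintegral_mulr0 mulr0.
  by rewrite /right_moment Cintegral_mulr0 mulr0.
have L0 e : L2 a ((fun (_ : 'I_(nedge G)) (_ : R) => 0 : R[i]) e).
  exact/L2_continuous/ccontinuous_cst.
have UF : U *m fmatrix + source (fun _ _ => 0) = 0 by rewrite UM F0 addr0.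
have HF := green_fundamental L0 UF; have [_ _ Hb _] := HF.
have ph p : phase p != 0.
  apply/eqP => p0; have /eqP := phaseNr th1 th2 p.
  by rewrite p0 mulr0 eq_sym oner_eq0.
have [e /orP[/eqP ev|/eqP ev]] := Hv v.
- apply: (eigenfunction_spectrum a_gt0 q_L2 HF zero_itv (e := e)).
  by rewrite (Hb e).1 ev mulf_neq0.
- apply: (eigenfunction_spectrum a_gt0 q_L2 HF a_itv (e := e)).
  by rewrite (Hb e).2 ev mulf_neq0.
Qed.

Let total_sqnorm F : R := \sum_e L2_Rsqnorm a (F e).

Let total_sqnorm_ge0 F : 0 <= total_sqnorm F.
Proof. by apply: sumr_ge0 => e _; exact: L2_Rsqnorm_ge0. Qed.

Let le_total_sqnorm F e : L2_Rsqnorm a (F e) <= total_sqnorm F.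
Proof.
rewrite /total_sqnorm (bigD1 e)//= lerDl sumr_ge0// => e' _.
exact: L2_Rsqnorm_ge0.
Qed.

(** Invertibility gives [U] as minus [source F] times the inverse matrix, so the solution is a
    finite sum of moments of [F] with bounded coefficients. *)
Lemma green_bounded : \det fmatrix != 0 -> exists C, 0 <= C /\
  forall F (U : 'rV[R[i]]_(nvertex G)), (forall e, L2 a (F e)) ->
    U *m fmatrix + source F = 0 -> forall e x, x \in `[0, a] ->
    sqnormc (gr F U e S T x) <= C * total_sqnorm F.
Proof.
move=> det0; have Mu : fmatrix \in unitmx by rewrite unitmxE unitfE.
(* The evaluation point is part of the datum, which makes the bounds uniform in it. *)
pose D : Type := (('I_(nedge G) -> R -> R[i]) * R)%type.
pose V (d : D) := (forall e, L2 a (d.1 e)) /\ d.2 \in `[0, a].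
pose N (d : D) := total_sqnorm d.1.
pose bounded := square_bounded V N.
have momentB u (pt : D -> R) e : ccontinuous a u ->
    (forall d, V d -> pt d \in `[0, a]) ->
    bounded (fun d => Cintegral `[0, pt d] (fun t => u t * d.1 e t)).
  move=> cu Hpt; have [M [M0 HM]] := sqnormc_Cintegral_le a_ge0 cu.
  exists M; split=> // d Vd; apply: le_trans (HM _ _ (Vd.1 e) (Hpt d Vd)) _.
  by apply: ler_wpM2l => //; exact: le_total_sqnorm.
have leftx e : bounded (fun d => left_moment S (d.1 e) d.2).
  by apply: (momentB S snd) => // d [].
have lefta e : bounded (fun d => left_moment S (d.1 e) a).
  exact: (momentB S (fun=> a)).
have rightx e : bounded (fun d => right_moment T (d.1 e) d.2).
  by apply: (momentB T snd) => // d [].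
have righta e : bounded (fun d => right_moment T (d.1 e) a).
  exact: (momentB T (fun=> a)).
have sourceB v : bounded (fun d => source d.1 0 v).
  have : bounded (fun d =>
      \sum_(e | tl e == v) phase (- tlp e) * right_moment T (d.1 e) a +
      \sum_(e | hd e == v) phase (- hdp e) * left_moment S (d.1 e) a).
    apply: square_boundedD; apply: square_bounded_sum => e; apply: square_boundedZ.
      exact: righta.
    exact: lefta.
  by congr bounded; apply/funext => d; rewrite mxE.
pose U (d : D) := - source d.1 *m invmx fmatrix.
have UB w : bounded (fun d => U d 0 w).
  have : bounded (fun d => \sum_v - invmx fmatrix v w * source d.1 0 v).
    by apply: square_bounded_sum => v; apply: square_boundedZ; exact: sourceB.
  congr bounded; apply/funext => d; rewrite mxE; apply: eq_bigr => v _.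
  by rewrite [in RHS]mxE; ring.
have [MS [_ HMS]] := ccontinuous_sqnormc_bounded cS.
have [MT [_ HMT]] := ccontinuous_sqnormc_bounded cT.
have grB e : bounded (fun d => gr d.1 (U d) e S T d.2).
  have : bounded (fun d => (S a)^-1 *
     (T d.2 * (phase (tlp e) * U d 0 (tl e) + left_moment S (d.1 e) d.2) +
      S d.2 * ((phase (hdp e) * U d 0 (hd e) + right_moment T (d.1 e) a)
               + -1 * right_moment T (d.1 e) d.2))).
    apply: square_boundedZ; apply: square_boundedD.
      apply: (@square_boundedM _ _ _ _ MT) => [d [_]|]; first exact: HMT.
      by apply: square_boundedD (leftx e); apply: square_boundedZ (UB _).
    apply: (@square_boundedM _ _ _ _ MS) => [d [_]|]; first exact: HMS.
    apply: square_boundedD (square_boundedZ _ (rightx e)).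
    by apply: square_boundedD (righta e); apply: square_boundedZ (UB _).
  by congr bounded; apply/funext => d; rewrite /gr /green; ring.
pose C e := projT1 (cid (grB e)).
have HC e : 0 <= C e /\ forall d, V d -> sqnormc (gr d.1 (U d) e S T d.2) <= C e * N d.
  exact: projT2 (cid (grB e)).
exists (\sum_e C e); split=> [|F U' FL HU e x xa].
  by apply: sumr_ge0 => e _; exact: (HC e).1.
have -> : U' = U (F, x).
  rewrite /U -[in LHS](mulmxK Mu U'); congr (_ *m _).
  by apply/eqP; rewrite -addr_eq0 HU.
apply: le_trans ((HC e).2 (F, x) _) _ => //.
apply: ler_wpM2r; first exact: total_sqnorm_ge0.
by rewrite (bigD1 e)//= lerDl sumr_ge0// => e' _; exact: (HC e').1.
Qed.

Lemma det_neq0_resolvent : \det fmatrix != 0 ->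
  bloch_resolvent_set G a q th1 th2 lam.
Proof.
move=> det0; have Mu : fmatrix \in unitmx by rewrite unitmxE unitfE.
split=> [f [fL fp]|].
  pose F e := f e 0; pose U := - source F *m invmx fmatrix.
  have UF : U *m fmatrix + source F = 0 by rewrite mulmxKV// addNr.
  have FL e : L2 a (F e) by exact: fL.
  have HF := green_fundamental FL UF.
  exists (fun e p x => phase p * gr F U e S T x).
  apply: (fundamental_bloch a_gt0 q_L2 HF) => e p x xa.
  by have := fp e 0 p x xa; rewrite add0r => ->; rewrite /F /phase; ring.
have [C [C0 HC]] := green_bounded det0.
(* The pointwise bound is integrated over an edge of length [a] and summed over the edges. *)
exists ((nedge G)%:R * (a * C)) => y z /(bloch_fundamental lam a_gt0 q_L2)[Y1 [U0 HF]].
pose F : 'I_(nedge G) -> R -> R[i] := fun e x => z e 0 x - lam * y e 0 x.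
pose U : 'rV[R[i]]_(nvertex G) := \row_v U0 v.
have {}HF : fundamental (fun e => y e 0) Y1 F (fun v => U 0 v).
  by move: HF; congr fundamental_solution; apply/funext => v; rewrite mxE.
have [UF Yg] := fundamental_green HF; have [hY FL _ _] := HF.
have -> : bloch_sqnorm a (fun e p x => z e p x - lam * y e p x) = (total_sqnorm F)%:E.
  rewrite /bloch_sqnorm /total_sqnorm -sumEFin; apply: eq_bigr => e _.
  exact: L2_sqnormE (FL e).
have cy e : ccontinuous a (y e 0) by exact: helmholtz_continuous (hY e).
have -> : bloch_sqnorm a y = (\sum_e L2_Rsqnorm a (y e 0))%:E.
  rewrite /bloch_sqnorm -sumEFin; apply: eq_bigr => e _.
  exact: L2_sqnormE (L2_continuous (cy e)).
rewrite -EFinM lee_fin.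
apply: (@le_trans _ _ (\sum_(e < nedge G) (a * (C * total_sqnorm F)))).
  apply: ler_sum => e _; apply: L2_sqnorm_le => //.
  - exact: mulr_ge0.
  - exact: L2_continuous.
  - by move=> x xa; rewrite Yg//; exact: HC.
by rewrite sumr_const card_ord -[leLHS]mulr_natl !mulrA.
Qed.

End S_a_neq0.

Theorem bloch_spectrumE : (nvertex G < nedge G)%N ->
  (forall v, exists e, (tl e == v) || (hd e == v)) ->
  spectrum <-> S a = 0 \/ \det fmatrix = 0.
Proof.
move=> VE Hv; have [Sa0|Sa0] := eqVneq (S a) 0.
  by split=> _; [left|exact: S_a_eq0_spectrum].
split=> [lam_s|[/eqP Sa|]].
- right; apply/eqP; apply: contrapT => /negP det0.
  by apply: lam_s; exact: det_neq0_resolvent.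
- by rewrite (negbTE Sa0) in Sa.
- exact: det_eq0_spectrum.
Qed.

End spectrum.

(** * Determinants of the four tilings *)

(** Entries indexed by natural numbers keep the minors in the same form, with indices that reduce by
    computation under repeated expansion. *)
Lemma det_nat_mx (K : comNzRingType) n (f : nat -> nat -> K) :
  \det (\matrix_(i < n.+1, j < n.+1) f i j) =
  \sum_(j < n.+1) f 0 j *
    ((-1) ^+ j * \det (\matrix_(i < n, k < n) f i.+1 (bump j k))).
Proof.
rewrite (expand_det_row _ ord0); apply: eq_bigr => j _.
rewrite mxE /cofactor add0n; congr (_ * (_ * \det _)).
by apply/matrixP => i k; rewrite !mxE.
Qed.

Lemma det_nat_mx2 (K : comNzRingType) (f : nat -> nat -> K) :
  \det (\matrix_(i < 2, j < 2) f i j) = f 0 0 * f 1 1 - f 0 1 * f 1 0.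
Proof.
by rewrite det_nat_mx !big_ord_recl big_ord0 !det_mx11 !mxE /=; ring.
Qed.

Lemma det_nat_mx3 (K : comNzRingType) (f : nat -> nat -> K) :
  \det (\matrix_(i < 3, j < 3) f i j) =
  f 0 0 * (f 1 1 * f 2 2 - f 1 2 * f 2 1) -
  f 0 1 * (f 1 0 * f 2 2 - f 1 2 * f 2 0) +
  f 0 2 * (f 1 0 * f 2 1 - f 1 1 * f 2 0).
Proof.
rewrite det_nat_mx.
under eq_bigr do rewrite (det_nat_mx2 (fun i k => f i.+1 (bump _ k))).
by rewrite !big_ord_recl big_ord0 /=; ring.
Qed.

Section tilings.
Context {R : realType}.
Variables th1 th2 : R.

Local Notation X := (expi th1).
Local Notation Y := (expi th2).

Lemma expi_neq0 (t : R) : expi t != 0.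
Proof.
apply/eqP => t0; have := expiD t (- t).
by rewrite subrr expi0 t0 mul0r => /eqP; rewrite oner_eq0.
Qed.

Lemma expiN (t : R) : expi (- t) = (expi t)^-1.
Proof.
by apply: (mulfI (expi_neq0 t)); rewrite -expiD subrr expi0 divff// expi_neq0.
Qed.

Lemma cos_expi (t : R) : (cos t)%:C = (expi t + (expi t)^-1) / 2.
Proof.
rewrite -expiN; apply: (mulIf (_ : 2 != 0 :> R[i])); first by rewrite pnatr_eq0.
rewrite mulfVK ?pnatr_eq0//; apply: complex_eqP.
  by rewrite ReD ReM /= cosN; ring.
by rewrite ImD ImM /= sinN; ring.
Qed.

Lemma expi_intM (t : R) (m : int) : expi (m%:~R * t) = expi t ^ m.
Proof.
have H n : expi (n%:R * t) = expi t ^+ n.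
  elim: n => [|n IHn]; first by rewrite mul0r expi0.
  by rewrite -natr1 mulrDl mul1r expiD IHn exprSr.
case: m => n; first exact: H.
by rewrite NegzE -exprnN -H -expiN intrN mulNr.
Qed.

Lemma phase_expi (p : int * int) : phase th1 th2 p = X ^ p.1 * Y ^ p.2.
Proof. by rewrite /phase expiD !expi_intM. Qed.

(** Written in half angles, both sides agree as polynomials once squared sines are replaced by 1
    minus squared cosines. *)
Lemma cos_half_prod (x y : R) :
  4 * (cos (x / 2) * cos (y / 2) * cos ((x - y) / 2)) =
  1 + cos x + cos y + cos (x - y).
Proof.
have cos2 (t : R) : cos t = 2 * cos (t / 2) ^+ 2 - 1.
  have {1}-> : t = t / 2 + t / 2 by field.
  by rewrite cosD; have := cos2Dsin2 (t / 2); rewrite !expr2; lra.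
rewrite (cos2 x) (cos2 y) (cos2 (x - y)).
have -> : cos ((x - y) / 2) = cos (x / 2) * cos (y / 2) + sin (x / 2) * sin (y / 2).
  by rewrite mulrBl cosB.
have := cos2Dsin2 (x / 2); have := cos2Dsin2 (y / 2).
(* The first cosine and sine met in the goal are those of [y / 2]: thus [cx], [sx] belong to [y / 2]
   and [cy], [sy] to [x / 2]. *)
set cx := cos _; set cy := cos _; set sx := sin _; set sy := sin _ => Ey Ex.
have -> : (cy * cx + sy * sx) ^+ 2 =
    cy ^+ 2 * cx ^+ 2 + 2 * cx * cy * sx * sy + sy ^+ 2 * sx ^+ 2 by ring.
have -> : sx ^+ 2 = 1 - cx ^+ 2 by rewrite -Ey addrAC subrr add0r.
have -> : sy ^+ 2 = 1 - cy ^+ 2 by rewrite -Ex addrAC subrr add0r.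
ring.
Qed.

(** Summing over the list of edges instead of their indices lets the sums of a concrete tiling
    unfold. *)
Lemma floquet_matrix_seqE G s : floquet_matrix G th1 th2 s =
  \matrix_(w, v) (\sum_(x <- ends G | x.1.1 == v)
      (X ^ (x.2.2.1 - x.1.2.1) * Y ^ (x.2.2.2 - x.1.2.2) * (x.2.1 == w)%:R
       - s * (v == w)%:R) +
    \sum_(x <- ends G | x.2.1 == v)
      (X ^ (x.1.2.1 - x.2.2.1) * Y ^ (x.1.2.2 - x.2.2.2) * (x.1.1 == w)%:R
       - s * (v == w)%:R)).
Proof.
apply/matrixP => w v; rewrite !mxE [in RHS]big_tuple [X in _ = _ + X]big_tuple.
by congr (_ + _); apply: eq_bigr => e _; rewrite phase_expi.
Qed.

Lemma real_complexD (x y : R) : (x + y)%:C = x%:C + y%:C.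
Proof. exact: rmorphD. Qed.

Lemma real_complexM (x y : R) : (x * y)%:C = x%:C * y%:C.
Proof. exact: rmorphM. Qed.

Lemma cos_half_prod_expi (x y : R) :
  (cos (x / 2) * cos (y / 2) * cos ((x - y) / 2))%:C =
  (1 + (expi x + (expi x)^-1) / 2 + (expi y + (expi y)^-1) / 2 +
   (expi x / expi y + expi y / expi x) / 2) / 4.
Proof.
apply: (mulfI (_ : 4 != 0 :> R[i])); first by rewrite pnatr_eq0.
rewrite [RHS]mulrC mulfVK ?pnatr_eq0//.
have -> : 4 * (cos (x / 2) * cos (y / 2) * cos ((x - y) / 2))%:C =
    (4 * (cos (x / 2) * cos (y / 2) * cos ((x - y) / 2)))%:C.
  by rewrite [RHS]rmorphM rmorph_nat.
rewrite cos_half_prod !real_complexD !cos_expi expiD expiN.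
by rewrite invfM invrK [_^-1 * expi y]mulrC.
Qed.

Let subzE := ((erefl : 1 - 0 = 1 :> int), (erefl : 0 - 0 = 0 :> int),
  (erefl : -1 - 0 = -1 :> int), (erefl : 0 - 1 = -1 :> int),
  (erefl : 0 - -1 = 1 :> int)).

(** Each of the three edges is a loop on the single vertex class and contributes its phase, the
    inverse phase and [-2 s]. *)
Lemma det_triangular s : \det (floquet_matrix triangular_tiling th1 th2 s) =
  -2 * (3 * s + 1 -
    4 * (cos (th1 / 2) * cos (th2 / 2) * cos ((th2 - th1) / 2))%:C).
Proof.
have X0 := expi_neq0 th1; have Y0 := expi_neq0 th2.
rewrite floquet_matrix_seqE det_mx11 mxE !big_cons !big_nil /=.
rewrite !subzE !expr1z !expr0z !exprN1.
rewrite [cos (th1 / 2) * _]mulrC cos_half_prod_expi.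
field.
by rewrite X0 Y0.
Qed.

Lemma det_elongated_triangular s :
  \det (floquet_matrix elongated_triangular_tiling th1 th2 s) =
  25 * s ^+ 2 - 20 * (cos th1)%:C * s -
    8 * (cos (th1 / 2) * cos (th2 / 2) * cos ((th1 - th2) / 2))%:C +
    4 * (cos th1 ^+ 2)%:C - 1.
Proof.
have X0 := expi_neq0 th1; have Y0 := expi_neq0 th2.
(* The inner lists are the columns, one per vertex: the Kirchhoff equation at a vertex of degree
   5. *)
pose f i j := nth 0 (nth [::]
  [:: [:: X + X^-1 - 5 * s; X^-1 * Y + X^-1 + 1];
      [:: X * Y^-1 + X + 1; X + X^-1 - 5 * s]] j) i.
have -> : floquet_matrix elongated_triangular_tiling th1 th2 s =
    \matrix_(i < 2, j < 2) f i j.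
  rewrite floquet_matrix_seqE; apply/matrixP => i j.
  rewrite !mxE big_mkcond [X in _ + X]big_mkcond !big_cons !big_nil /=.
  rewrite !subzE ?expr1z ?expr0z ?exprN1 /f.
  (* The entries agree as polynomials in four independent letters, so [ring] settles each of
     them. *)
  move: X^-1 Y^-1 X Y => x' y' x y.
  case: i => [[|[|//]] i]; case: j => [[|[|//]] j] /=; ring.
rewrite det_nat_mx2 /f /=.
rewrite cos_half_prod_expi expr2 real_complexM cos_expi.
field.
by rewrite X0 Y0.
Qed.

Lemma det_truncated_square s :
  \det (floquet_matrix truncated_square_tiling th1 th2 s) =
  81 * s ^+ 4 - 54 * s ^+ 2 - 12 * s * (cos th1 + cos th2)%:C + 1 -
    4 * (cos th1 * cos th2)%:C.
Proof.
have X0 := expi_neq0 th1; have Y0 := expi_neq0 th2.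
pose f i j := nth 0 (nth [::]
  [:: [:: -3 * s; 1; X^-1; 1];
      [:: 1; -3 * s; 1; Y^-1];
      [:: X; 1; -3 * s; 1];
      [:: 1; Y; 1; -3 * s]] j) i.
have -> : floquet_matrix truncated_square_tiling th1 th2 s =
    \matrix_(i < 4, j < 4) f i j.
  rewrite floquet_matrix_seqE; apply/matrixP => i j.
  rewrite !mxE big_mkcond [X in _ + X]big_mkcond !big_cons !big_nil /=.
  rewrite !subzE ?expr1z ?expr0z ?exprN1 /f.
  move: X^-1 Y^-1 X Y => x' y' x y.
  case: i => [[|[|[|[|//]]]] i]; case: j => [[|[|[|[|//]]]] j] /=; ring.
rewrite det_nat_mx.
under eq_bigr do rewrite (det_nat_mx3 (fun i k => f i.+1 (bump _ k))).
rewrite !big_ord_recl big_ord0 /f /=.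
rewrite real_complexD real_complexM !cos_expi.
field.
by rewrite X0 Y0.
Qed.

(** Opposite off-diagonal entries multiply to 4 times the squares of the three half-angle cosines,
    and these squares sum to 1 plus twice their product; hence [2 * s + 1] splits off, a factor
    independent of the quasimomenta. *)
Lemma det_trihexagonal s :
  \det (floquet_matrix trihexagonal_tiling th1 th2 s) =
  -16 * ((2 * s + 1) * (2 * s ^+ 2 - s -
    (cos (th1 / 2) * cos (th2 / 2) * cos ((th1 - th2) / 2))%:C)).
Proof.
have X0 := expi_neq0 th1; have Y0 := expi_neq0 th2.
pose f i j := nth 0 (nth [::]
  [:: [:: -4 * s; 1 + X^-1; 1 + Y^-1];
      [:: 1 + X; -4 * s; 1 + X * Y^-1];
      [:: 1 + Y; 1 + X^-1 * Y; -4 * s]] j) i.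
have -> : floquet_matrix trihexagonal_tiling th1 th2 s =
    \matrix_(i < 3, j < 3) f i j.
  rewrite floquet_matrix_seqE; apply/matrixP => i j.
  rewrite !mxE big_mkcond [X in _ + X]big_mkcond !big_cons !big_nil /=.
  rewrite !subzE ?expr1z ?expr0z ?exprN1 /f.
  move: X^-1 Y^-1 X Y => x' y' x y.
  case: i => [[|[|[|//]]] i]; case: j => [[|[|[|//]]] j] /=; ring.
rewrite det_nat_mx3 /f /= cos_half_prod_expi.
field.
by rewrite X0 Y0.
Qed.

End tilings.

(** * The dispersion relations *)

Theorem theorem1p1 (R : realType) (a : R) (a_gt0 : 0 < a)
    (q : R -> R) (q_L2 : L2_real a q) (q_even : even_potential a q)
    (th1 th2 : R) (th1_pi : -pi <= th1 <= pi) (th2_pi : -pi <= th2 <= pi)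
    (rho : R[i]) (S S' : R -> R[i])
    (S_sol : solves_schrodinger a q (rho ^+ 2) S S')
    (S_0 : S 0 = 0) (S'_0 : S' 0 = 1) :
  [/\ bloch_spectrum triangular_tiling a q th1 th2 (rho ^+ 2) <->
        S a ^+ 2 * (3 * S' a + 1 -
          4 * (cos (th1 / 2) * cos (th2 / 2) * cos ((th2 - th1) / 2))%:C) = 0,
      bloch_spectrum elongated_triangular_tiling a q th1 th2 (rho ^+ 2) <->
        S a ^+ 3 * (25 * S' a ^+ 2 - 20 * (cos th1)%:C * S' a -
          8 * (cos (th1 / 2) * cos (th2 / 2) * cos ((th1 - th2) / 2))%:C +
          4 * (cos th1 ^+ 2)%:C - 1) = 0,
      bloch_spectrum truncated_square_tiling a q th1 th2 (rho ^+ 2) <->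
        S a ^+ 2 * (81 * S' a ^+ 4 - 54 * S' a ^+ 2 -
          12 * S' a * (cos th1 + cos th2)%:C + 1 -
          4 * (cos th1 * cos th2)%:C) = 0 &
      bloch_spectrum trihexagonal_tiling a q th1 th2 (rho ^+ 2) <->
        S a ^+ 3 * (2 * S' a + 1) * (2 * S' a ^+ 2 - S' a -
          (cos (th1 / 2) * cos (th2 / 2) * cos ((th1 - th2) / 2))%:C) = 0].
Proof.
have hS := solves_schrodinger_helmholtz a_gt0 q_L2 S_sol.
pose spectrumE G := bloch_spectrumE (G := G) th1 th2 a_gt0 q_L2 q_even hS S_0 S'_0.
(* The determinant [D] is the bracket [P] up to a nonzero constant, and a positive power of [S a]
   vanishes exactly when [S a] does. *)
have zeroE n (D P : R[i]) (c : R[i]) : c != 0 -> D = c * P ->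
    S a = 0 \/ D = 0 <-> S a ^+ n.+1 * P = 0.
  move=> c0 ->; split=> [[->|/eqP]|/eqP].
  - by rewrite expr0n mul0r.
  - by rewrite mulf_eq0 (negbTE c0) => /eqP->; rewrite mulr0.
  - by rewrite mulf_eq0 expf_eq0/= => /orP[/eqP|/eqP->]; [left|right; rewrite mulr0].
have n0 n : (n.+1%:R : R[i]) != 0 by rewrite pnatr_eq0.
split.
- apply: iff_trans (spectrumE triangular_tiling _ _) _ => //.
    by move=> v; exists ord0; rewrite [v]ord1.
  by apply: zeroE (det_triangular th1 th2 _); rewrite oppr_eq0.
- apply: iff_trans (spectrumE elongated_triangular_tiling _ _) _ => //.
    case=> [[|[|//]] v]; first by exists (@Ordinal 5 0 isT).
    by exists (@Ordinal 5 4 isT).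
  by apply: zeroE (oner_neq0 _) _; rewrite mul1r det_elongated_triangular.
- apply: iff_trans (spectrumE truncated_square_tiling _ _) _ => //.
    case=> [[|[|[|[|//]]]] v]; first by exists (@Ordinal 6 0 isT).
    + by exists (@Ordinal 6 0 isT).
    + by exists (@Ordinal 6 2 isT).
    + by exists (@Ordinal 6 2 isT).
  by apply: zeroE (oner_neq0 _) _; rewrite mul1r det_truncated_square.
- apply: iff_trans (spectrumE trihexagonal_tiling _ _) _ => //.
    case=> [[|[|[|//]]] v]; first by exists (@Ordinal 6 0 isT).
    + by exists (@Ordinal 6 2 isT).
    + by exists (@Ordinal 6 0 isT).
  rewrite -mulrA.
  by apply: zeroE (det_trihexagonal th1 th2 _); rewrite oppr_eq0.
Qed.
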